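(* Let $k,m,n$ be integers with $1\le k\le \min(m,n)$. The ghost generating functions satisfy the following equations (with the dependence on the complex variable $t$ suppressed), by means of which they can be computed recursively. For $d=0$, $$F_{k,m,n}^{(0)} = \frac{t}{n}\cdot F_{k,m,n}^{(1)} + F_{k-1,m,n-1}^{(0)},$$ and for every integer $d$ with $1\le d\le k$, $$F_{k,m,n}^{(d)} = \left(1-\frac{d\cdot t}{(m-k+d)\cdot n}\right)^{-1}\cdot\left(\frac{1}{m-k+d}\cdot F_{k-1,m,n-1}^{(d-1)} + \frac{d+1}{n}\cdot t\cdot F_{k,m,n}^{(d+1)} + F_{k-1,m,n-1}^{(d)}\right).$$ Here $F_{0,m,n'}^{(0)}=1$ for all $m,n'\geq 0$, and when $d=k$ the terms involving $F_{k,m,n}^{(k+1)}$ and $F_{k-1,m,n-1}^{(k)}$ are zero.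
   Context: Let $A=\{a_1,\dots,a_m\}$ and $B=\{b_1,\dots,b_n\}$, and let $g$ be an extra vertex (the ghost vertex). Consider the complete bipartite graph with vertex sets $A+g=\{a_1,\dots,a_m,g\}$ and $B$. All edge costs are independent; each ordinary edge $(a_i,b_j)$ has cost exponentially distributed with mean $1$, and each ghost edge $(g,b_j)$ has cost exponentially distributed with mean $1/h$, where $h>0$ is a parameter. A $k$-matching in this extended graph is a set of $k$ edges such that every vertex other than $g$ is in at most one of them (any number of edges from $g$ is allowed). Its cost is the sum of its edge costs. For integers $0\le k\le\min(m,n)$, $C_{k,m,n}$ is the minimum cost of a $k$-matching in the extended graph (it depends implicitly on $h$), and $I_{k,m,n}(d)$ is the indicator variable of the event that exactly $d$ ghost edges participate in the (almost surely unique) minimum cost $k$-matching. The ghost generating function is $$F_{k,m,n}^{(d)}(t)=\lim_{h\to0}\frac{1}{h^d}\,\mathbb{E}\left[\exp(t\cdot C_{k,m,n})\cdot I_{k,m,n}(d)\right],\qquad d\ge 0.$$ It is considered for complex $t$ with $\operatorname{Re}(t)\le 0$, where all the expectations converge; being rational functions of $t$, the functions are then identified with their continuations as rational functions. The function $F_{k,m,n}^{(0)}(t)$ is the moment generating function of the minimum cost of a $k$-matching in the original $m$ by $n$ complete bipartite graph without ghost vertex. *)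

(* Defs.v *)
From HB Require Import structures.
From mathcomp Require Import all_boot all_order all_algebra.
From mathcomp Require Import complex.
From mathcomp Require Import all_classical all_reals all_analysis.

Set Implicit Arguments.
Unset Strict Implicit.
Unset Printing Implicit Defensive.

Import Order.TTheory GRing.Theory Num.Theory.
Import numFieldNormedType.Exports.

Local Open Scope classical_set_scope.
Local Open Scope ring_scope.
Local Open Scope complex_scope.

(* The vertex set [A + g] is [option 'I_m]: [Some i] is a_i, [None] is the
   ghost g.  The vertex set B is ['I_n]. *)
Definition edge (m n : nat) := (option 'I_m * 'I_n)%type.

Definition is_ghost_edge m n (e : edge m n) : bool := e.1 == None.

Definition kmatching m n (k : nat) (M : {set edge m n}) : bool :=
  [&& #|M| == k,
      [forall i : 'I_m, (#|[set e in M | e.1 == Some i]| <= 1)%N]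
    & [forall j : 'I_n, (#|[set e in M | e.2 == j]| <= 1)%N]].

Definition ghost_count m n (M : {set edge m n}) : nat :=
  #|[set e in M | is_ghost_edge e]|.

Definition mutually_independent disp (T : measurableType disp) (R : realType)
    (P : probability T R) (I : finType) (X : I -> {RV P >-> R}) : Prop :=
  forall (J : {set I}) (S : I -> set R),
    (forall i, i \in J -> measurable (S i)) ->
    P (\bigcap_(i in [set` J]) (X i @^-1` S i)) =
    (\prod_(i in J) P (X i @^-1` S i))%E.

(* The mean is the reciprocal of the rate.  [distribution] and
   [exponential_prob] are total on [set R], so they are compared on measurable
   sets only. *)
Definition exponentially_distributed disp (T : measurableType disp)
    (R : realType) (P : probability T R) (rate : R) (X : {RV P >-> R}) : Prop :=
  forall S : set R, measurable S -> distribution P X S = exponential_prob rate S.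

Definition ghost_edge_costs disp (T : measurableType disp) (R : realType)
    (P : probability T R) m n (h : R) (X : edge m n -> {RV P >-> R}) : Prop :=
  mutually_independent X /\
  forall e, exponentially_distributed (if is_ghost_edge e then h else 1) (X e).

Definition matching_cost disp (T : measurableType disp) (R : realType)
    (P : probability T R) m n (X : edge m n -> {RV P >-> R})
    (M : {set edge m n}) (w : T) : R :=
  \sum_(e in M) X e w.

(* For [k <= minn m n] this is the infimum of a finite nonempty set, that is,
   a minimum. *)
Definition min_cost disp (T : measurableType disp) (R : realType)
    (P : probability T R) m n (X : edge m n -> {RV P >-> R}) (k : nat)
    (w : T) : R :=
  inf [set matching_cost X M w | M in [set M | kmatching k M]].

(* The events for different [d] are disjoint only up to a null set: the minimum
   cost [k]-matching is almost surely unique. *)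
Definition ghost_event disp (T : measurableType disp) (R : realType)
    (P : probability T R) m n (X : edge m n -> {RV P >-> R}) (k d : nat) :
    set T :=
  [set w | exists M : {set edge m n},
     [/\ kmatching k M, matching_cost X M w = min_cost X k w
        & ghost_count M = d]].

Definition cexp (R : realType) (z : R[i]) : R[i] :=
  (expR (complex.Re z))%:C * (cos (complex.Im z) +i* sin (complex.Im z)).

Definition cexpectation disp (T : measurableType disp) (R : realType)
    (P : probability T R) (f : T -> R[i]) : R[i] :=
  fine 'E_P[fun w => complex.Re (f w)] +i* fine 'E_P[fun w => complex.Im (f w)].

Definition scaled_ghost_mgf disp (T : measurableType disp) (R : realType)
    (P : probability T R) m n (X : edge m n -> {RV P >-> R}) (k d : nat)
    (h : R) (t : R[i]) : R[i]^o :=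
  ((h ^+ d)%:C)^-1 *
  cexpectation P (fun w => cexp (t * (min_cost X k w)%:C)
                           * (\1_(ghost_event X k d) w)%:C).

(* [R[i]^o] carries the topology of the complex modulus. *)
Definition ghost_gf disp (R : realType) (T : R -> measurableType disp)
    (P : forall h, probability (T h) R) m n
    (X : forall h, edge m n -> {RV (P h) >-> R}) (k d : nat) (t : R[i]) :
    R[i]^o :=
  lim (scaled_ghost_mgf (X h) k d h t @[h --> 0^'+]).

Definition closed_left_halfplane (R : realType) : set R[i] :=
  [set t | complex.Re t <= 0].

(* The rational function [F] has no pole in [D] and takes the value [f t] at
   each [t] in [D]; for infinite [D] this determines [F]. *)
Definition represents (R : realType) (D : set R[i]) (F : {fraction {poly R[i]}})
    (f : R[i] -> R[i]) : Prop :=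
  exists num den : {poly R[i]},
    F = FracField.tofrac num / FracField.tofrac den /\
    forall t, D t -> den.[t] != 0 /\ f t = num.[t] / den.[t].

Definition ratX (R : realType) : {fraction {poly R[i]}} :=
  FracField.tofrac 'X.

(* Main.v *)
(* Fix b in B.  Let M, of cost C, be the minimum cost k-matching and M', of cost
   Y, the minimum cost (k-1)-matching avoiding b.  The recursion already holds
   for every h > 0, with m-k+d replaced by m-k+d+h in suitable places, and the
   limit h -> 0 is taken at the end, by induction on k and downwards on d.

   Two identities are combined.  First, M uses the A-vertices of M' and exactly
   one new one.  Given the costs of M' and of the cheapest edge from an unused
   A-vertex to each b_j, the new vertex is chosen by competing exponential
   clocks: with probability h/(m-k+d+h) the number d-1 of ghost edges goes up by
   one, independently of C.  Secondly, C = min(X, Y + Z) where Z is the cost of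
   (g,b) and X, Y do not depend on it, so that integrating by parts in Z gives
     E[e^(tC); M' has d ghost edges]
       = E[e^(tY); M' has d ghost edges]
         + (t/h) E[e^(tC); M has d+1 ghost edges, one of which is (g,b)].
   Summing over b turns the last indicator into a factor d+1.

   Complex exponentials are handled through the real test functions Re e^(tx)
   and Im e^(tx). *)
Require Import Defs.
From HB Require Import structures.
From mathcomp Require Import all_boot all_order all_algebra.
From mathcomp Require Import complex.
From mathcomp Require Import all_classical all_reals all_analysis.
From mathcomp Require Import measurable_realfun.
From mathcomp Require Import zify ring lra.

Set Implicit Arguments.
Unset Strict Implicit.
Unset Printing Implicit Defensive.

Import Order.TTheory GRing.Theory Num.Theory.
Import numFieldNormedType.Exports.

Local Open Scope ring_scope.

(** * Matchings and exchanges *)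

(** A minimum matching with d ghost edges has probability at most of order h^d, which explains the
    scale h^-d. A new ghost edge brings a factor h and the integration by parts a factor h^-1, so
    that after scaling all coefficients have finite limits. The second identity, used with d-1 ghost
    edges in M', brings back the unknown for d; solving for it produces the inverse factor, which
    has no pole where Re t <= 0. The number m-k+d counts the vertices a_i left free by the k-1 edges
    of M' when d-1 of them are ghost edges.

    The delicate point is that the clocks are independent of C, although C depends on all costs.
    This is shown for two edges in one column at a time, a ghost edge and an ordinary edge from a
    free vertex. If one of them is the new edge of M, then the other, which is dearer, can be
    lowered to the same cost, and an exchange argument shows that M and M' remain optimal. The
    weight of the pair is therefore a function of the smaller cost alone, and interchanging the two
    edges changes its expectation by the ratio h of their rates. *)

Section exchange.
Context (E L B : finType) (r : E -> L) (c : E -> B).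
Implicit Types (M N : {set E}) (e f : E) (v u : L).

(** The edge type and the endpoint maps are abstract because the exchange below is applied both to
    [edge m n] and to [option (edge m n)]. *)
Definition matching M := {in M &, injective r} /\ {in M &, injective c}.

Lemma matchingS M N : M \subset N -> matching N -> matching M.
Proof.
by move=> /fintype.subsetP MN [rN cN]; split=> x y /MN xN /MN yN; [exact: rN|exact: cN].
Qed.

Lemma matchingU1 M e : matching M -> r e \notin r @: M -> c e \notin c @: M ->
  matching (e |: M).
Proof.
move=> [rM cM] re ce; split=> x y /setU1P[->|xM] /setU1P[->|yM] // h.
- by rewrite h imset_f in re.
- by rewrite -h imset_f in re.
- exact: rM.
- by rewrite h imset_f in ce.
- by rewrite -h imset_f in ce.
- exact: cM.
Qed.

Lemma imsetD1_in (T : finType) (g : E -> T) M e : {in M &, injective g} -> e \in M ->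
  g @: (M :\ e) = (g @: M) :\ g e.
Proof.
move=> gM eM; apply/setP => t; apply/imsetP/setD1P.
  move=> [x /setD1P[xe xM] ->]; split; last exact: imset_f.
  by apply: contraNneq xe => /gM -> //.
move=> [tge /imsetP[x xM tx]]; exists x => //.
by rewrite !inE xM andbT; apply: contraNneq tge => <-; rewrite tx.
Qed.

(** A walk from [v] hands the edge of [N] at [v] to [M], returns an edge of [M] to [N], and goes on
    from the vertex of the returned edge until that vertex is one that only [M] used. Equal sizes
    guarantee an edge to return even where the column is free in [M]. No edge is created or lost, so
    the total cost is preserved whatever the costs are. *)
Lemma exchange M N v : matching M -> matching N -> #|M| = #|N| ->
  v \in r @: N -> v \notin r @: M ->
  exists M1 N1 u,
    [/\ matching M1 /\ matching N1, u \in r @: M /\ u \notin r @: N,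
        r @: M1 = v |: (r @: M :\ u), r @: N1 = u |: (r @: N :\ v)
      & forall e, ((e \in M1) + (e \in N1) = (e \in M) + (e \in N))%N].
Proof.
move: {2}#|N| (erefl #|N|) => n; elim: n M N v => [|n IH] M N v nN mM mN MN.
  by move/eqP: nN; rewrite cards_eq0 => /eqP->; rewrite imset0 inE.
move=> /imsetP[e eN ve] vM; subst v.
have eM : e \notin M by apply: contra vM => eM; exact: imset_f.
have [rM cM] := mM; have [rN cN] := mN.
(* One step along the alternating path from [v]; if the path would end in a
   column not used by [M], it jumps to a column of [M] not used by [N]. *)
have [f [fM cfN ceM]] : exists f, [/\ f \in M, c f \notin c @: (N :\ e) & c e \notin c @: (M :\ f)].
  have [/imsetP[f fM ef]|ceM] := boolP (c e \in c @: M).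
    exists f; split=> //; first by rewrite imsetD1_in// -ef !inE eqxx.
    by rewrite imsetD1_in// -ef !inE eqxx.
  have : ~~ (c @: M \subset c @: N).
    apply: contra ceM => MsubN.
    have /eqP -> : c @: M == c @: N by rewrite eqEcard MsubN !card_in_imset// MN leqnn.
    exact: imset_f.
  case/subsetPn => _ /imsetP[f fM ->] cf; exists f; split=> //.
    by apply: contra cf => /imsetP[x /setD1P[_ xN] ->]; exact: imset_f.
  by apply: contra ceM => /imsetP[x /setD1P[_ xM] ->]; exact: imset_f.
set M0 := M :\ f; set N0 := N :\ e.
have mM0 : matching M0 by exact: matchingS (subD1set _ _) mM.
have mN0 : matching N0 by exact: matchingS (subD1set _ _) mN.
have cM0N0 : #|M0| = #|N0|.
  by apply/eqP; move: MN; rewrite (cardsD1 f) fM (cardsD1 e N) eN => /eqP.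
have rM0 : r @: M0 = r @: M :\ r f by exact: imsetD1_in.
have rN0 : r @: N0 = r @: N :\ r e by exact: imsetD1_in.
have reM0 : r e \notin r @: M0 by rewrite rM0 !inE negb_and vM orbT.
have re_rf : r e != r f by apply: contraNneq vM => ->; exact: imset_f.
have ef : e != f by apply: contraNneq re_rf => ->.
have rfM0 : r f \notin r @: M0 by rewrite rM0 !inE eqxx.
have ceN0 : c e \notin c @: N0 by rewrite imsetD1_in// !inE eqxx.
have cfM0 : c f \notin c @: M0 by rewrite imsetD1_in// !inE eqxx.
have fN : f \notin N.
  apply: contra cfN => fN; apply: imset_f; rewrite !inE fN andbT.
  by rewrite eq_sym.
(* If [N] does not use [r f], the walk ends with [u = r f]. Otherwise [M0] and [N0] form a smaller
   instance that starts at [r f]. *)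
have [rfN|rfN] := boolP (r f \in r @: N); last first.
  exists (e |: M0), (f |: N0), (r f); split.
  - split; apply: matchingU1 => //.
    by rewrite rN0 !inE negb_and rfN orbT.
  - by split=> //; exact: imset_f.
  - by rewrite imsetU1 rM0.
  - by rewrite imsetU1 rN0.
  - move=> x; rewrite !inE; have [->|xe] := eqVneq x e.
      by rewrite (negPf ef) eN (negPf eM).
    by have [->|xf] := eqVneq x f; rewrite //= fM (negPf fN).
have rfN0 : r f \in r @: N0 by rewrite rN0 !inE rfN eq_sym re_rf.
have nN0 : #|N0| = n by move: nN; rewrite (cardsD1 e) eN => -[].
have [M1 [N1 [u [[mM1 mN1] [uM0 uN0] rM1 rN1 cnt]]]] := IH M0 N0 (r f) nN0 mM0 mN0 cM0N0 rfN0 rfM0.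
(* The matchings from the induction hypothesis consist of edges of [M0] and [N0], so the columns of
   [e] and [f] are still free in them. *)
have sub1 x : x \in M1 -> (x \in M0) || (x \in N0).
  by move=> xM1; have := cnt x; rewrite xM1; case: (_ \in M0); case: (_ \in N0).
have sub2 x : x \in N1 -> (x \in M0) || (x \in N0).
  by move=> xN1; have := cnt x; rewrite xN1; case: (_ \in M0); case: (_ \in N0); case: (_ \in M1).
have u_rf : u != r f by apply: contraTneq uM0 => ->.
have u_re : u != r e by apply: contraTneq uM0 => ->.
exists (e |: M1), (f |: N1), u; split.
- split; apply: matchingU1 => //.
  + by rewrite rM1 !inE negb_or negb_and re_rf reM0 orbT.
  + apply/imsetP => -[x /sub1/orP[] xM cx].
      by rewrite cx imset_f in ceM.
    by rewrite cx imset_f in ceN0.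
  + by rewrite rN1 !inE negb_or eq_sym u_rf eqxx.
  + apply/imsetP => -[x /sub2/orP[] xM cx].
      by rewrite cx imset_f in cfM0.
    by rewrite cx imset_f in cfN.
- split; first by move: uM0; rewrite rM0 => /setD1P[].
  by move: uN0; rewrite rN0 !inE u_re.
- rewrite imsetU1 rM1 rM0; apply/setP => t; rewrite !inE.
  have [->|] := eqVneq t (r f); rewrite //= ?orbF.
  by rewrite [r f == u]eq_sym (negPf u_rf) imset_f// !orbT.
- rewrite imsetU1 rN1 rN0; apply/setP => t; rewrite !inE.
  have [->|] := eqVneq t (r f); rewrite //= ?orbF.
  by rewrite rfN [r f == r e]eq_sym re_rf orbT.
- move=> x; rewrite !inE; have := cnt x; rewrite !inE.
  have [->|xe] := eqVneq x e.
    by rewrite (negPf ef) eN (negPf eM) /=; case: (_ \in M1); case: (_ \in N1).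
  have [->|xf] := eqVneq x f; last by rewrite /=.
  by rewrite /= fM (negPf fN) /=; case: (_ \in M1); case: (_ \in N1).
Qed.
End exchange.

(** * Exchanges between k-matchings of the extended graph *)

Section matchings.
Context (m n : nat).
Implicit Types (M N : {set edge m n}) (e : edge m n) (b : 'I_n) (k : nat).

(* The ghost is split into one vertex [inr j] per ghost edge (g, b_j).  As b_j is
   used at most once, this does not change the k-matchings, and every vertex on
   the side of A is now used at most once. *)
Definition lab e : 'I_m + 'I_n := if e.1 is Some i then inl i else inr e.2.

Lemma kmatchingP k M :
  reflect (matching lab snd M /\ #|M| = k) (kmatching k M).
Proof.
apply: (iffP and3P) => [[/eqP Mk /forallP rM /forallP cM]|[[rM cM] Mk]].
  have cinj : {in M &, injective (@snd (option 'I_m) 'I_n)}.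
    move=> e f eM fM ef; have /card_le1_eqP/(_ f e) := cM e.2.
    by apply; rewrite inE ?eM ?fM ?ef eqxx.
  split=> //; split=> // e f eM fM; rewrite /lab.
  case ei : e.1 => [i|]; case fi : f.1 => [i'|] //= [].
    move=> ii; have /card_le1_eqP/(_ f e) := rM i.
    by apply; rewrite inE ?eM ?fM ?ei ?fi ?ii eqxx.
  by move=> /cinj; apply.
split; first exact/eqP.
  apply/forallP => i; apply/card_le1_eqP => e f; rewrite !inE.
  move=> /andP[eM /eqP ei] /andP[fM /eqP fi]; apply: rM => //.
  by rewrite /lab ei fi.
apply/forallP => j; apply/card_le1_eqP => e f; rewrite !inE.
by move=> /andP[eM /eqP ej] /andP[fM /eqP fj]; apply: cM => //; rewrite ej fj.
Qed.

Definition avoids b k M := kmatching k M && (b \notin snd @: M).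

Lemma kmatching_exists k : (k <= minn m n)%N -> exists M, kmatching k M && (ghost_count M == 0%N).
Proof.
rewrite leq_min => /andP[km kn].
pose g (i : 'I_k) : edge m n := (Some (widen_ord km i), widen_ord kn i).
have g2 : injective (snd \o g) by move=> i j /(congr1 val)/= /val_inj.
have glab : injective (lab \o g) by move=> i j [] /val_inj.
exists (g @: 'I_k); apply/andP; split.
  apply/kmatchingP; split; last by rewrite card_imset ?card_ord// => i j ij; apply: g2; congr (snd _); exact: ij.
  by split=> _ _ /imsetP[i _ ->] /imsetP[j _ ->] h; [have := glab i j h|have := g2 i j h] => ->.
apply/eqP; rewrite /ghost_count; apply/eqP; rewrite cards_eq0; apply/eqP/setP => e.
by rewrite !inE; apply/negP => /andP[/imsetP[i _ ->]].
Qed.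

(* [None] is an additional edge from a new vertex to [b]: a matching avoiding [b]
   becomes a matching containing [None], of the size of those without it. *)
Definition lab_ext (o : option (edge m n)) : option ('I_m + 'I_n) := omap lab o.
Definition col_ext b (o : option (edge m n)) : 'I_n := if o is Some e then e.2 else b.

Lemma ext_kmatching b k M : kmatching k M ->
  matching lab_ext (col_ext b) (Some @: M) /\ #|Some @: M| = k.
Proof.
move=> /kmatchingP[[rM cM] Mk]; split; last by rewrite card_imset// => x y [].
by split=> _ _ /imsetP[x xM ->] /imsetP[y yM ->] /= => [[/rM ->]|/cM ->].
Qed.

Lemma ext_avoids b k M : avoids b k M ->
  matching lab_ext (col_ext b) (None |: Some @: M) /\ #|None |: Some @: M| = k.+1.
Proof.
move=> /andP[/(ext_kmatching b)[mM Mk] bM]; split.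
  apply: matchingU1 => //; first by apply/imsetP => -[_ /imsetP[x _ ->]].
  apply: contra bM => /imsetP[_ /imsetP[x xM ->] /= ->]; exact: imset_f.
by rewrite cardsU1 Mk; case: imsetP => // -[].
Qed.

Lemma ext_inv b (S : {set option (edge m n)}) k :
  matching lab_ext (col_ext b) S -> #|S| = k.+1 ->
  if None \in S then avoids b k (Some @^-1: S) else kmatching k.+1 (Some @^-1: S).
Proof.
move=> [rS cS] Sk.
have mS : matching lab snd (Some @^-1: S).
  by split=> e f; rewrite !inE => eS fS h; apply: Some_inj; [apply: rS|apply: cS]; rewrite //= h.
have imS : Some @: (Some @^-1: S) = S :\ None.
  apply/setP => o; apply/imsetP/setD1P => [[e]|[]].
    by rewrite inE => eS ->.
  by case: o => // e _ eS; exists e; rewrite ?inE.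
have cardS : #|Some @^-1: S| = #|S :\ None|.
  by rewrite -imS card_imset// => x y [].
case: ifPn => NS; last first.
  by apply/kmatchingP; split=> //; rewrite cardS; have := cardsD1 None S; rewrite (negPf NS) Sk.
apply/andP; split.
  by apply/kmatchingP; split=> //; rewrite cardS; have := cardsD1 None S; rewrite NS Sk => -[].
apply/imsetP => -[e]; rewrite inE => eS be.
by have := cS None (Some e) NS eS be.
Qed.

Lemma mem_lab_ext (S : {set option (edge m n)}) v :
  (Some v \in lab_ext @: S) = (v \in lab @: (Some @^-1: S)).
Proof.
apply/imsetP/imsetP => [[[e|//] eS [->]]|[e]]; first by exists e; rewrite ?inE.
by rewrite inE => eS ->; exists (Some e).
Qed.

Lemma mem_None_ext (S : {set option (edge m n)}) : (None \in lab_ext @: S) = (None \in S).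
Proof. by apply/imsetP/idP => [[[]//]|NS]; exists None. Qed.

Definition same_edges M1 N1 M N :=
  forall e, ((e \in M1) + (e \in N1) = (e \in M) + (e \in N))%N.

Lemma preimSomeU M : Some @^-1: (None |: Some @: M) = M.
Proof.
by apply/setP => e; rewrite !inE /=; apply/imsetP/idP => [[f fM [->]]//|eM]; exists e.
Qed.

Lemma preimSome M : Some @^-1: (Some @: M) = M.
Proof.
by apply/setP => e; rewrite !inE /=; apply/imsetP/idP => [[f fM [->]]//|eM]; exists e.
Qed.

Lemma None_imset M : (None \in Some @: M) = false.
Proof. by apply/imsetP => -[]. Qed.

Lemma exchange_avoids b k M N v : avoids b k M -> kmatching k.+1 N ->
  v \in lab @: M -> v \notin lab @: N ->
  exists M1 N1, [/\ avoids b k M1, kmatching k.+1 N1, v \in lab @: N1 & same_edges M1 N1 M N].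
Proof.
move=> /ext_avoids[mM Mk] /(ext_kmatching b)[mN Nk] vM vN.
have [|||N1 [M1 [u [[mN1 mM1] [uN uM] rN1 rM1 cnt]]]] := @exchange _ _ _ _ _ _ _ (Some v) mN mM.
- by rewrite Mk Nk.
- by rewrite mem_lab_ext preimSomeU.
- by rewrite mem_lab_ext preimSome.
have uN0 : u != None by apply: contraNneq uM => ->; rewrite mem_None_ext !inE.
have NM1 : None \in M1 by rewrite -mem_None_ext rM1 !inE eq_sym (negPf uN0) /= mem_None_ext !inE.
have NN1 : None \notin N1.
  by rewrite -mem_None_ext rN1 !inE /= mem_None_ext None_imset andbF.
have cM1 : #|M1| = k.+1.
  rewrite -Mk -(card_in_imset mM1.1) -(card_in_imset mM.1) rM1.
  by rewrite cardsU1 !inE (negPf uM) andbF /= [RHS](cardsD1 (Some v)) mem_lab_ext preimSomeU vM.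
have cN1 : #|N1| = k.+1.
  rewrite -Nk -(card_in_imset mN1.1) -(card_in_imset mN.1) rN1.
  rewrite cardsU1 !inE mem_lab_ext preimSome (negPf vN) andbF /=.
  by rewrite [RHS](cardsD1 u) uN.
exists (Some @^-1: M1), (Some @^-1: N1); split.
- by have := ext_inv mM1 cM1; rewrite NM1.
- by have := ext_inv mN1 cN1; rewrite (negPf NN1).
- by rewrite -mem_lab_ext rN1 !inE eqxx.
- move=> e; rewrite !inE; have := cnt (Some e).
  by rewrite addnC => ->; rewrite addnC !inE /= !mem_imset// => x y [].
Qed.

(** Here the vertex given in return for [v] may be [None]. In that case the matchings trade roles,
    which is the first alternative. *)
Lemma exchange_kmatching b k M N v : avoids b k M -> kmatching k.+1 N ->
  v \in lab @: N -> v \notin lab @: M ->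
  exists M1 N1, [/\ same_edges M1 N1 M N, lab @: M1 \subset v |: lab @: M &
    (kmatching k.+1 M1 && avoids b k N1) ||
    [&& avoids b k M1, kmatching k.+1 N1 & v \notin lab @: N1]].
Proof.
move=> /ext_avoids[mM Mk] /(ext_kmatching b)[mN Nk] vN vM.
have [|||M1 [N1 [u [[mM1 mN1] [uM uN] rM1 rN1 cnt]]]] := @exchange _ _ _ _ _ _ _ (Some v) mM mN.
- by rewrite Mk Nk.
- by rewrite mem_lab_ext preimSome.
- by rewrite mem_lab_ext preimSomeU.
have cM1 : #|M1| = k.+1.
  rewrite -Mk -(card_in_imset mM1.1) -(card_in_imset mM.1) rM1.
  rewrite cardsU1 !inE mem_lab_ext preimSomeU (negPf vM) andbF /=.
  by rewrite [RHS](cardsD1 u) uM.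
have cN1 : #|N1| = k.+1.
  rewrite -Nk -(card_in_imset mN1.1) -(card_in_imset mN.1) rN1.
  by rewrite cardsU1 !inE (negPf uN) andbF /= [RHS](cardsD1 (Some v)) mem_lab_ext preimSome vN.
exists (Some @^-1: M1), (Some @^-1: N1); split.
- move=> e; rewrite !inE; have := cnt (Some e) => ->.
  by rewrite !inE /= !mem_imset// => x y [].
- apply/fintype.subsetP => w; rewrite -mem_lab_ext rM1 !inE mem_lab_ext preimSomeU.
  by move=> /orP[/eqP[->]|/andP[_ ->]]; rewrite ?eqxx ?orbT.
- have := ext_inv mM1 cM1; have := ext_inv mN1 cN1.
  have -> : (None \in N1) = (u == None).
    by rewrite -mem_None_ext rN1 !inE mem_None_ext None_imset ?andbF ?orbF eq_sym.
  have -> : (None \in M1) = (u != None).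
    by rewrite -mem_None_ext rM1 !inE mem_None_ext !inE /= ?andbT eq_sym.
  have [uN0 /= -> ->//|uN0 /= -> ->] := eqVneq u None.
  rewrite -mem_lab_ext rN1 !inE eqxx /= orbF.
  by rewrite orbC; apply/orP; left; apply: contraNneq uN => <-; rewrite mem_lab_ext preimSome.
Qed.

(** The sizes agree without an additional edge, and [b] stays free because no edge is created. *)
Lemma exchange_avoids2 b k M N v : avoids b k M -> avoids b k N ->
  v \in lab @: N -> v \notin lab @: M ->
  exists M1 N1, [/\ same_edges M1 N1 M N, lab @: M1 \subset v |: lab @: M,
    avoids b k M1, avoids b k N1 & v \notin lab @: N1].
Proof.
move=> /andP[/kmatchingP[mM Mk] bM] /andP[/kmatchingP[mN Nk] bN] vN vM.
have [|||M1 [N1 [u [[mM1 mN1] [uM uN] rM1 rN1 cnt]]]] := @exchange _ _ _ _ _ _ _ v mM mN.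
- by rewrite Mk Nk.
- by [].
- by [].
have cM1 : #|M1| = k.
  rewrite -Mk -(card_in_imset mM1.1) -(card_in_imset mM.1) rM1.
  by rewrite cardsU1 !inE (negPf vM) andbF /= [RHS](cardsD1 u) uM.
have cN1 : #|N1| = k.
  rewrite -Nk -(card_in_imset mN1.1) -(card_in_imset mN.1) rN1.
  by rewrite cardsU1 !inE (negPf uN) andbF /= [RHS](cardsD1 v) vN.
have avoid e : (e \in M1) || (e \in N1) -> b != e.2.
  move=> h; have : (e \in M) || (e \in N).
    by move: h (cnt e); case: (_ \in M1); case: (_ \in N1); case: (_ \in M); case: (_ \in N).
  by move=> /orP[eM|eN]; [apply: contraNneq bM|apply: contraNneq bN] => ->; exact: imset_f.
exists M1, N1; split=> //.
- apply/fintype.subsetP => w; rewrite rM1 !inE.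
  by move=> /orP[/eqP->|/andP[_ ->]]; rewrite ?eqxx ?orbT.
- apply/andP; split; first exact/kmatchingP.
  by apply/imsetP => -[e eM1 be]; have := avoid e; rewrite eM1 be eqxx => /(_ isT).
- apply/andP; split; first exact/kmatchingP.
  by apply/imsetP => -[e eN1 be]; have := avoid e; rewrite eN1 orbT be eqxx => /(_ isT).
- rewrite rN1 !inE eqxx /= orbF; apply: contraNneq uN => <-; exact: vN.
Qed.
End matchings.
Arguments lab {m n}.

(** * Minimum cost matchings *)

Definition upd (R : Type) (I : eqType) (x : I -> R) (e : I) (z : R) : I -> R :=
  fun i => if i == e then z else x i.

Section weights.
Context (R : realType) (E : finType).
Implicit Types (M N : {set E}) (e : E) (F : pred {set E}) (x y : E -> R).

Definition cost x M := \sum_(e in M) x e.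

Definition optimal F x M : bool := F M && [forall N, F N ==> (cost x M <= cost x N)].

Definition optimum F x : R := inf [set cost x M | M in [set M | F M]].

Lemma optimalP F x M : reflect (F M /\ forall N, F N -> cost x M <= cost x N) (optimal F x M).
Proof.
apply: (iffP andP) => -[FM /=].
  by move/forallP => h; split=> // N; move/implyP: (h N).
by move=> h; split=> //; apply/forallP => N; apply/implyP; exact: h.
Qed.

Lemma optimal_exists F x M0 : F M0 -> exists M, optimal F x M.
Proof.
move=> FM0; case: (@arg_minP _ _ _ M0 F (cost x) FM0) => M FM h.
by exists M; apply/optimalP.
Qed.

Lemma optimum_optimal F x M : optimal F x M -> optimum F x = cost x M.
Proof.
move=> /optimalP[FM h]; apply/eqP; rewrite eq_le; apply/andP; split.
  apply: ge_inf; last by exists M.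
  by exists (cost x M) => _ [N FN <-]; exact: h.
by apply: lb_le_inf; [exists (cost x M), M|move=> _ [N FN <-]; exact: h].
Qed.

Lemma optimal_unique F x M N : injective (cost x) -> optimal F x M -> optimal F x N -> M = N.
Proof.
move=> inj /optimalP[FM hM] /optimalP[FN hN]; apply: inj; apply/eqP.
by rewrite eq_le hM// hN.
Qed.

Lemma cost_indicator x M : cost x M = \sum_e x e *+ (e \in M).
Proof. by rewrite /cost big_mkcond; apply: eq_bigr => e _; case: ifP; rewrite ?mulr1n. Qed.

Lemma cost_same_edges x M1 N1 M N :
  (forall e, ((e \in M1) + (e \in N1) = (e \in M) + (e \in N))%N) ->
  cost x M1 + cost x N1 = cost x M + cost x N.
Proof.
move=> cnt; rewrite !cost_indicator -!big_split; apply: eq_bigr => e _ /=.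
by rewrite -!mulrnDr cnt.
Qed.

Lemma cost_upd x e z M : e \notin M -> cost (upd x e z) M = cost x M.
Proof.
move=> eM; apply: eq_bigr => f fM; rewrite /upd.
by case: eqP => // fe; rewrite -fe fM in eM.
Qed.

Lemma costD1 x e M : e \in M -> cost x M = x e + cost x (M :\ e).
Proof. by move=> eM; rewrite /cost (big_setD1 e). Qed.

Lemma costU1 x e M : e \notin M -> cost x (e |: M) = x e + cost x M.
Proof. by move=> eM; rewrite /cost big_setU1. Qed.

Lemma optimal_upd F x e z M : (forall N, F N -> e \notin N) ->
  optimal F (upd x e z) M = optimal F x M.
Proof.
move=> Fe; apply/optimalP/optimalP => -[FM h]; split=> // N FN; have := h N FN.
  by rewrite !cost_upd ?Fe.
by rewrite !cost_upd ?Fe.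
Qed.

Lemma optimum_upd F x e z : (forall N, F N -> e \notin N) ->
  optimum F (upd x e z) = optimum F x.
Proof.
move=> Fe; congr inf; apply/seteqP; split=> _ [N FN <-]; exists N => //.
  by rewrite cost_upd// Fe.
by rewrite cost_upd// Fe.
Qed.

Definition swap e e' M := e |: (M :\ e').

Lemma cost_swap x e e' M : e' \in M -> e \notin M ->
  cost x (swap e e' M) = cost x M + x e - x e'.
Proof.
move=> e'M eM; rewrite costU1; last by rewrite !inE (negPf eM) andbF.
by rewrite (costD1 x e'M); ring.
Qed.

End weights.

(** * Exchange arguments for optimal matchings *)

Section lowering.
Context (R : realType) (m n : nat).
Implicit Types (M N : {set edge m n}) (e : edge m n) (b : 'I_n) (k : nat).
Implicit Types x y : edge m n -> R.

Lemma kmatching_swap k M e e' : kmatching k M -> e' \in M ->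
  lab e \notin lab @: (M :\ e') -> e.2 = e'.2 -> kmatching k (swap e e' M).
Proof.
move=> /kmatchingP[mM Mk] e'M le ee'; apply/kmatchingP; split.
  apply: matchingU1 => //; first exact: matchingS (subD1set _ _) mM.
  by rewrite (imsetD1_in mM.2 e'M) ee' !inE eqxx.
rewrite cardsU1 (_ : e \notin _ = true).
  by rewrite -Mk (cardsD1 e' M) e'M.
by apply: contra le => eM; exact: imset_f.
Qed.

Lemma avoids_swap b k M e e' : avoids b k M -> e' \in M ->
  lab e \notin lab @: (M :\ e') -> e.2 = e'.2 -> avoids b k (swap e e' M).
Proof.
move=> /andP[kM bM] e'M le ee'; apply/andP; split; first exact: kmatching_swap.
apply: contra bM => /imsetP[f]; rewrite !inE => /orP[/eqP->|/andP[_ fM]] ->.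
  by rewrite ee'; exact: imset_f.
exact: imset_f.
Qed.

Lemma optimal_le_swap k x M e e' : optimal (kmatching k) x M -> e \in M -> e' \notin M ->
  lab e' \notin lab @: (M :\ e) -> e'.2 = e.2 -> x e <= x e'.
Proof.
move=> /optimalP[kM h] eM e'M le ee'.
by have := h _ (kmatching_swap kM eM le ee'); rewrite cost_swap//; lra.
Qed.

(** Between the two cost functions only competitors that contain [e] change, and they do not become
    cheaper. *)
Lemma optimal_raise (F : pred {set edge m n}) x e z M : e \notin M -> z <= x e ->
  optimal F (upd x e z) M -> optimal F x M.
Proof.
move=> eM zx /optimalP[FM h]; apply/optimalP; split=> // N FN.
apply: (@le_trans _ _ (cost (upd x e z) N)).
  by rewrite -(cost_upd x z eM); exact: h.
by apply: ler_sum => f _; rewrite /upd; case: eqP => [->|].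
Qed.

(* Lowering [x e'] to [x e] does not affect the optimality of [M'] and [M]: the
   costs in a column of the edges from vertices unused by [M'] only matter
   through their minimum. *)
Section lower.
Variables (b : 'I_n) (k : nat) (M' M : {set edge m n}) (e e' : edge m n) (x : edge m n -> R).
Hypotheses (col : e.2 = e'.2) (lee' : lab e != lab e').
Hypotheses (le : lab e \notin lab @: M') (le' : lab e' \notin lab @: M') (e'M : e' \notin M).
Hypotheses (xee' : x e <= x e').
Hypothesis optM' : optimal (avoids b k) x M'.
Hypothesis optM : optimal (kmatching k.+1) x M.

Let y := upd x e' (x e).

Let e'M' : e' \notin M'.
Proof. by apply: contra le' => ?; exact: imset_f. Qed.

Let ynot N : e' \notin N -> cost y N = cost x N.
Proof. exact: cost_upd. Qed.

Let yswap N : e' \in N -> lab e \notin lab @: N -> cost y N = cost x (swap e e' N).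
Proof.
move=> e'N leN.
have eN : e \notin N by apply: contra leN => ?; exact: imset_f.
rewrite -ynot; last first.
  by rewrite !inE eqxx /= orbF; apply: contraNneq lee' => ->.
rewrite cost_swap// /y /upd eqxx; case: eqP => [->|_]; by rewrite addrK.
Qed.

Let notlab N : lab @: N \subset lab e |: lab @: M' -> e' \notin N.
Proof.
move=> /fintype.subsetP sub; apply: contra lee' => e'N.
have := sub _ (imset_f lab e'N); rewrite !inE (negPf le') orbF.
by rewrite eq_sym.
Qed.

Let labD N : lab e \notin lab @: N -> lab e \notin lab @: (N :\ e').
Proof. by apply: contra => /imsetP[f /setD1P[_ fN] ->]; exact: imset_f. Qed.

(** A competitor containing [e'] but not the vertex of [e] costs what its swap costs under [x], so
    it is no threat. If it uses the vertex of [e], an exchange with [M'] moves this vertex away: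
    [M1] does not contain [e'], [N1] is of the harmless kind, and the two costs sum to those of [M']
    and the competitor. *)
Lemma optimal_lower_avoids : optimal (avoids b k) y M'.
Proof.
have /optimalP[kM' hM'] := optM'.
have swapped N : avoids b k N -> e' \in N -> lab e \notin lab @: N -> cost y M' <= cost y N.
  move=> kN e'N leN; rewrite (yswap e'N leN) ynot//; apply: hM'.
  by apply: avoids_swap => //; exact: labD.
apply/optimalP; split=> // N kN.
have [e'N|e'N] := boolP (e' \in N); last by rewrite !ynot//; exact: hM'.
have [leN|leN] := boolP (lab e \in lab @: N); last exact: swapped.
have [M1 [N1 [cnt sub kM1 kN1 leN1]]] := exchange_avoids2 kM' kN leN le.
have e'M1 := notlab sub.
have e'N1 : e' \in N1 by have := cnt e'; rewrite (negPf e'M1) e'N (negPf e'M'); case: (_ \in N1).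
have := cost_same_edges y cnt.
have := swapped _ kN1 e'N1 leN1.
have : cost y M' <= cost y M1 by rewrite !ynot//; exact: hM'.
lra.
Qed.

Lemma optimal_lower_kmatching : optimal (kmatching k.+1) y M.
Proof.
have /optimalP[kM' hM'] := optimal_lower_avoids.
have /optimalP[kM hM] := optM.
have swapped N : kmatching k.+1 N -> e' \in N -> lab e \notin lab @: N -> cost y M <= cost y N.
  move=> kN e'N leN; rewrite (yswap e'N leN) ynot//; apply: hM.
  by apply: kmatching_swap => //; exact: labD.
apply/optimalP; split=> // N kN.
have [e'N|e'N] := boolP (e' \in N); last by rewrite !ynot//; exact: hM.
have [leN|leN] := boolP (lab e \in lab @: N); last exact: swapped.
have [M1 [N1 [cnt sub h]]] := exchange_kmatching kM' kN leN le.
have e'M1 := notlab sub.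
have e'N1 : e' \in N1 by have := cnt e'; rewrite (negPf e'M1) e'N (negPf e'M'); case: (_ \in N1).
have := cost_same_edges y cnt.
(* In the first alternative the sizes are interchanged, so [M1] is compared with [M] and [N1] with
   [M']; in the second it is the other way round. *)
case/orP: h => [/andP[kM1 kN1]|/and3P[kM1 kN1 leN1]].
  have := hM' _ kN1; have : cost y M <= cost y M1 by rewrite !ynot//; exact: hM.
  lra.
have := hM' _ kM1; have := swapped _ kN1 e'N1 leN1; lra.
Qed.
End lower.

(** If [M] missed a vertex of [M'], an exchange would give two matchings of the same kinds and the
    same total cost. Both would then be optimal, and uniqueness would identify [N1], which uses that
    vertex, with [M]. Comparing sizes leaves exactly one vertex more. *)
Lemma optimal_nested b k x M' M : injective (cost x) ->
  optimal (avoids b k) x M' -> optimal (kmatching k.+1) x M ->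
  exists2 e, e \in M & lab e \notin lab @: M' /\ lab @: (M :\ e) = lab @: M'.
Proof.
move=> inj optM' optM; have /optimalP[kM' hM'] := optM'; have /optimalP[kM hM] := optM.
have sub : lab @: M' \subset lab @: M.
  apply/fintype.subsetP => v vM'; apply/negPn/negP => vM.
  have [M1 [N1 [kM1 kN1 vN1 cnt]]] := exchange_avoids kM' kM vM' vM.
  have cE := cost_same_edges x cnt.
  have c1 := hM' _ kM1; have c2 := hM _ kN1.
  have NM : M = N1 by apply: inj; lra.
  by rewrite NM vN1 in vM.
have /andP[/kmatchingP[mM' cM'] _] := kM'; have /kmatchingP[mM cM] := kM.
have /cards1P[v vE] : #|lab @: M :\: lab @: M'| == 1%N.
  rewrite cardsD (finset.setIidPr sub) !card_in_imset//; [|exact: mM'.1|exact: mM.1].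
  by rewrite cM cM' subSnn.
have /setDP[/imsetP[e eM ve] vM'] : v \in lab @: M :\: lab @: M' by rewrite vE inE.
exists e => //; rewrite -ve; split=> //.
rewrite (imsetD1_in mM.1 eM) -ve -vE; apply/setP => w; rewrite !inE.
have [/(fintype.subsetP sub) ->//|wM'] := boolP (w \in lab @: M').
by rewrite /= andNb.
Qed.

(** With one ghost vertex per column, the number of ghost edges depends only on the set of vertices
    used. Nested vertex sets therefore control how it changes. *)
Lemma ghost_count_lab k M : kmatching k M ->
  ghost_count M = #|[set v in lab @: M | if v is inr _ then true else false]|.
Proof.
move=> /kmatchingP[[rM _] _].
rewrite /ghost_count -(@card_in_imset _ _ lab [set e in M | is_ghost_edge e]); last first.
  by move=> e f; rewrite !inE => /andP[eM _] /andP[fM _]; exact: rM.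
congr #|pred_of_set _|; apply/setP => v; rewrite inE; apply/imsetP/andP.
  move=> [e]; rewrite inE => /andP[eM ge] ->; split; first exact: imset_f.
  by move: ge; rewrite /lab /is_ghost_edge => /eqP->.
move=> [/imsetP[e eM ->] ge]; exists e => //; rewrite inE eM /=.
by move: ge; rewrite /lab /is_ghost_edge; case: e.1.
Qed.

Lemma ghost_count_sum M : ghost_count M = (\sum_(b < n) ((None, b) \in M))%N.
Proof.
rewrite /ghost_count -sum1_card.
rewrite (partition_big (fun e : edge m n => e.2) xpredT)//=; apply: eq_bigr => b _.
have [gM|gM] := boolP ((None, b) \in M).
  rewrite (big_pred1 (None, b))//; case=> o j; rewrite !inE /= /is_ghost_edge /=.
  apply/andP/eqP => [[/andP[_ /eqP->] /eqP->]//|[-> ->]].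
  by rewrite gM !eqxx.
rewrite big_pred0//; case=> o j; rewrite !inE /= /is_ghost_edge /=.
apply/negP => /andP[/andP[ojM /eqP oN] /eqP jb].
by rewrite oN jb (negPf gM) in ojM.
Qed.

(** The ordinary edges, [k - ghost_count M] in number, are those that occupy vertices a_i. *)
Lemma card_free_rows k M : kmatching k M -> (k <= m)%N ->
  #|[set a : 'I_m | inl a \notin lab @: M]| = (m - k + ghost_count M)%N.
Proof.
move=> kM km; have /kmatchingP[[rM _] cM] := kM.
have E : (#|[set a : 'I_m | inl a \in lab @: M]| + ghost_count M = k)%N.
  rewrite (ghost_count_lab kM) -cM -(card_in_imset rM).
  rewrite -(cardsID [set v : 'I_m + 'I_n | if v is inr _ then true else false] (lab @: M)) addnC.
  congr (_ + _)%N.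
    by congr #|pred_of_set _|; apply/setP => v; rewrite !inE.
  rewrite -(@card_imset _ _ (@inl 'I_m 'I_n)); last by move=> a a' [].
  congr #|pred_of_set _|; apply/setP => v; rewrite !inE; apply/imsetP/andP.
    by move=> [a]; rewrite inE => aM ->.
  by case: v => [a [_ aM]|j []//]; exists a; rewrite ?inE.
have := cardsC [set a : 'I_m | inl a \in lab @: M]; rewrite card_ord.
have -> : ~: [set a : 'I_m | inl a \in lab @: M] = [set a | inl a \notin lab @: M].
  by apply/setP => a; rewrite !inE.
by move: E km; set p := #|_|; set q := #|_|; set g := ghost_count M; lia.
Qed.

End lowering.

(** * The ghost edge at a fixed vertex of B *)

Section ghost_edge.
Context (R : realType) (m n : nat) (b : 'I_n) (k : nat).
Implicit Types (M N : {set edge m n}) (x : edge m n -> R).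
Let g : edge m n := (None, b).

Lemma ghost_notin_avoids M : avoids b k M -> g \notin M.
Proof. by move=> /andP[_]; apply: contra => gM; apply/imsetP; exists g. Qed.

(** The ghost may be used any number of times, so [b] being free is all that matters. *)
Lemma avoids_ghostU1 M : avoids b k M -> kmatching k.+1 (g |: M).
Proof.
move=> kM; have gM := ghost_notin_avoids kM; move/andP: kM => [/kmatchingP[mM Mk] bM].
apply/kmatchingP; split; last by rewrite cardsU1 gM Mk.
apply: matchingU1 => //; apply: contra gM => /imsetP[f fM lf].
suff -> : g = f by [].
by move: lf; rewrite /lab; case: f fM => -[i|] j fM //= [<-].
Qed.

Lemma kmatchingD1_avoids M f : kmatching k.+1 M -> f \in M ->
  b \notin snd @: (M :\ f) -> avoids b k (M :\ f).
Proof.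
move=> /kmatchingP[mM Mk] fM bM; apply/andP; split=> //; apply/kmatchingP; split.
  exact: matchingS (subD1set _ _) mM.
by move: Mk; rewrite (cardsD1 f) fM => -[].
Qed.

Lemma kmatchingD1_col M f : kmatching k.+1 M -> f \in M -> f.2 = b -> avoids b k (M :\ f).
Proof.
move=> kM fM fb; apply: kmatchingD1_avoids => //.
by have /kmatchingP[[_ cM] _] := kM; rewrite imsetD1_in// fb !inE eqxx.
Qed.

Lemma kmatching_avoids M : kmatching k.+1 M -> exists2 f, f \in M & avoids b k (M :\ f).
Proof.
move=> kM; have [/imsetP[f fM bf]|bM] := boolP (b \in snd @: M).
  by exists f => //; exact: kmatchingD1_col.
have /card_gt0P[f fM] : (0 < #|M|)%N by have /kmatchingP[_ ->] := kM.
exists f => //; apply: kmatchingD1_avoids => //.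
by apply: contra bM => /imsetP[f' /setD1P[_ f'M] ->]; exact: imset_f.
Qed.

(** Only the edge [(g, b)] is excluded; other ghost edges may occur. The optimum over this class is
    the competitor that does not depend on the cost of [(g, b)]. *)
Definition no_ghost M := kmatching k.+1 M && (g \notin M).

Lemma no_ghost_exists : (k.+1 <= minn m n)%N -> exists M, no_ghost M.
Proof.
move=> /kmatching_exists[M /andP[kM /eqP gM]]; exists M; rewrite /no_ghost kM /=.
have := ghost_count_sum M; rewrite gM; apply: contra_eqN => gM'.
by rewrite (bigD1 b)//= gM'.
Qed.

Lemma avoids_exists : (k.+1 <= minn m n)%N -> exists M, avoids b k M.
Proof.
by move=> /kmatching_exists[M /andP[/kmatching_avoids[f _ h] _]]; exists (M :\ f).
Qed.

Hypothesis kmn : (k.+1 <= minn m n)%N.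

Lemma optimum_no_ghost_exists x : exists M, optimal no_ghost x M.
Proof. by have [M /optimal_exists] := no_ghost_exists kmn; exact. Qed.

Lemma optimal_avoids_exists x : exists M, optimal (avoids b k) x M.
Proof. by have [M /optimal_exists] := avoids_exists kmn; exact. Qed.

Lemma optimal_kmatching_exists x : exists M, optimal (kmatching k.+1) x M.
Proof.
have [M /andP[kM _]] := no_ghost_exists kmn.
exact: (optimal_exists x kM).
Qed.

(** Removing [(g, b)] from a matching leaves one that avoids [b], and conversely [(g, b)] can be
    added to every matching that avoids [b]. *)
Lemma optimum_ghost x :
  optimum (kmatching k.+1) x = Num.min (optimum no_ghost x) (optimum (avoids b k) x + x g).
Proof.
have [M0 o0] := optimum_no_ghost_exists x.
have [MA oA] := optimal_avoids_exists x.
have [M oM] := optimal_kmatching_exists x.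
rewrite (optimum_optimal o0) (optimum_optimal oA) (optimum_optimal oM).
have /optimalP[/andP[k0 _] h0] := o0; have /optimalP[kA hA] := oA; have /optimalP[kM hM] := oM.
apply/eqP; rewrite eq_le le_min hM//=; apply/andP; split.
  by rewrite addrC -costU1 ?ghost_notin_avoids//; apply: hM; exact: avoids_ghostU1.
rewrite ge_min; have [gM|gM] := boolP (g \in M); last by rewrite h0// /no_ghost kM.
apply/orP; right; rewrite (costD1 x gM) addrC lerD2l; apply: hA.
exact: kmatchingD1_col.
Qed.

(** Dropping a suitable edge cannot raise the cost. The difference of the two sides is where the
    integral over the cost of [(g, b)] is cut off, so it has to be nonnegative. *)
Lemma optimum_avoids_le x : (forall e, 0 <= x e) ->
  optimum (avoids b k) x <= optimum no_ghost x.
Proof.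
move=> x0; have [M0 o0] := optimum_no_ghost_exists x.
have [MA oA] := optimal_avoids_exists x.
rewrite (optimum_optimal o0) (optimum_optimal oA).
have /optimalP[/andP[k0 _] h0] := o0; have /optimalP[kA hA] := oA.
have [f fM aM] := kmatching_avoids k0; rewrite (costD1 x fM).
by apply: (le_trans (hA _ aM)); rewrite lerDr.
Qed.

Lemma optimum_avoids_ge0 x : (forall e, 0 <= x e) -> 0 <= optimum (avoids b k) x.
Proof.
move=> x0; have [MA oA] := optimal_avoids_exists x.
by rewrite (optimum_optimal oA); apply: sumr_ge0.
Qed.

Lemma optimal_ghost_in x M M' : injective (cost x) ->
  optimal (kmatching k.+1) x M -> optimal (avoids b k) x M' ->
  (g \in M) = (optimum (avoids b k) x + x g <= optimum no_ghost x).
Proof.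
move=> inj oM oM'; have := optimum_ghost x.
have /optimalP[kM hM] := oM; have /optimalP[kM' hM'] := oM'.
have [M0 o0] := optimum_no_ghost_exists x; have /optimalP[/andP[k0 g0] h0] := o0.
rewrite (optimum_optimal o0) (optimum_optimal oM) (optimum_optimal oM').
have gM' := ghost_notin_avoids kM'.
move=> cM; apply/idP/idP.
  move=> gM; have := hM' _ (kmatchingD1_col kM gM erefl).
  have := costD1 x gM; have := hM _ k0; lra.
move=> h; have cE : cost x M = cost x (g |: M').
  rewrite costU1// addrC; apply/eqP; rewrite eq_le.
  by move: cM; rewrite min_r// => ->; rewrite lexx.
by rewrite (inj _ _ cE) !inE eqxx.
Qed.

Lemma ghost_countD1 M : g \in M -> ghost_count M = (ghost_count (M :\ g)).+1.
Proof.
move=> gM; rewrite /ghost_count (cardsD1 g) inE gM /= add1n; congr (_.+1).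
by congr #|pred_of_set _|; apply/setP => e; rewrite !inE andbA.
Qed.

(** Deleting [(g, b)] from the optimal [M] leaves an optimal matching avoiding [b], which is [M'] by
    uniqueness. *)
Lemma optimal_ghostD1 x M M' : injective (cost x) ->
  optimal (kmatching k.+1) x M -> optimal (avoids b k) x M' -> g \in M ->
  ghost_count M = (ghost_count M').+1.
Proof.
move=> inj oM oM' gM; rewrite ghost_countD1//; congr (ghost_count _).+1.
have /optimalP[kM hM] := oM; have /optimalP[kM' hM'] := oM'.
apply: inj; apply/eqP; rewrite eq_le hM' ?andbT; last exact: kmatchingD1_col.
have := hM _ (avoids_ghostU1 kM'); rewrite (costD1 x gM) costU1 ?ghost_notin_avoids//.
by rewrite lerD2l.
Qed.

End ghost_edge.

Lemma ghost_count_nested (m n k : nat) (M M' : {set edge m n}) e :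
  kmatching k M' -> kmatching k.+1 M -> e \in M -> lab @: (M :\ e) = lab @: M' ->
  ghost_count M = (ghost_count M' + is_ghost_edge e)%N.
Proof.
move=> kM' kM eM labE.
have kMe : kmatching k (M :\ e).
  have /kmatchingP[mM Mk] := kM; apply/kmatchingP; split.
    exact: matchingS (subD1set _ _) mM.
  by move: Mk; rewrite (cardsD1 e) eM => -[].
rewrite (ghost_count_lab kM') -labE -(ghost_count_lab kMe).
rewrite /ghost_count (cardsD1 e) inE eM /= addnC; congr (_ + _)%N.
by congr #|pred_of_set _|; apply/setP => f; rewrite !inE andbA.
Qed.

Lemma optimal_ghost_count (R : realType) (m n k : nat) (b : 'I_n) (x : edge m n -> R) M M' :
  injective (cost x) -> optimal (kmatching k.+1) x M -> optimal (avoids b k) x M' ->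
  exists t : bool, ghost_count M = (ghost_count M' + t)%N.
Proof.
move=> inj oM oM'; have [e eM [_ labE]] := optimal_nested inj oM' oM.
have /optimalP[kM _] := oM; have /optimalP[/andP[kM' _] _] := oM'.
by exists (is_ghost_edge e); exact: ghost_count_nested kM' kM eM labE.
Qed.

(** * Deleting a vertex of B *)

Section restriction.
Context (R : realType) (m n : nat) (b : 'I_n.+1).
Implicit Types (M : {set edge m n}) (x : edge m n.+1 -> R).

(** The image consists of the edges that miss [b]. This identifies the matchings avoiding [b] with
    those of a graph having one vertex less, the origin of the index n-1 in the recursion. *)
Definition widen_edge (e : edge m n) : edge m n.+1 := (e.1, lift b e.2).

Lemma widen_edge_inj : injective widen_edge.
Proof.
move=> [a j] [a' j'] h; have /= -> := congr1 fst h.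
by have /= /lift_inj -> := congr1 snd h.
Qed.

Lemma avoids_widen k M : avoids b k (widen_edge @: M) = kmatching k M.
Proof.
apply/andP/kmatchingP => [[/kmatchingP[[lM cM] kM] _]|[[lM cM] kM]].
  split; last by rewrite -kM card_imset//; exact: widen_edge_inj.
  split=> e f eM fM h; apply: widen_edge_inj.
    apply: lM; rewrite ?imset_f//; move: h; rewrite /lab /=.
    by case: e.1 => [i|]; case: f.1 => [i'|] //= [->].
  by apply: cM; rewrite ?imset_f//= h.
split; last by apply/imsetP => -[_ /imsetP[e eM ->] /= /eqP]; rewrite (negPf (neq_lift _ _)).
apply/kmatchingP; split; last by rewrite card_imset//; exact: widen_edge_inj.
split=> _ _ /imsetP[e eM ->] /imsetP[f fM ->] h; congr widen_edge.
  apply: lM => //; move: h; rewrite /lab /=.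
  by case: e.1 => [i|]; case: f.1 => [i'|] //= []; [move=> ->|move=> h; congr inr; apply: (@lift_inj _ b); exact: val_inj].
by apply: cM => //; move: h => /= /lift_inj.
Qed.

Lemma avoids_widen_ex k (N : {set edge m n.+1}) : avoids b k N ->
  exists M, N = widen_edge @: M.
Proof.
move=> /andP[_ bN]; exists (widen_edge @^-1: N); apply/setP => oj; case: oj => o j.
have [jb|bj] := eqVneq b j.
  apply/idP/imsetP => [ojN|[f fM /(congr1 snd)/= h]].
    by case/negP: bN; rewrite jb; apply/imsetP; exists (o, j).
  by have := neq_lift b f.2; rewrite -h jb eqxx.
have [j' jj' _] := unlift_some bj.
apply/idP/imsetP => [ojN|[f fM ->]]; last by rewrite inE in fM.
by exists (o, j'); rewrite ?inE /widen_edge /= -jj'.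
Qed.

Lemma cost_widen x M : cost x (widen_edge @: M) = cost (x \o widen_edge) M.
Proof. by rewrite /cost big_imset//=; move=> e f _ _; exact: widen_edge_inj. Qed.

Lemma ghost_count_widen M : ghost_count (widen_edge @: M) = ghost_count M.
Proof.
rewrite /ghost_count -(card_imset (mem [set e in M | is_ghost_edge e]) widen_edge_inj).
congr #|pred_of_set _|; apply/setP => e; rewrite inE; apply/andP/imsetP.
  by move=> [/imsetP[f fM ->] ge]; exists f => //; rewrite inE fM.
by move=> [f]; rewrite inE => /andP[fM gf] ->; rewrite imset_f.
Qed.

Lemma optimal_widen k x M :
  optimal (avoids b k) x (widen_edge @: M) = optimal (kmatching k) (x \o widen_edge) M.
Proof.
apply/optimalP/optimalP => -[kM h]; split; rewrite ?avoids_widen// in kM *.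
  by move=> N kN; rewrite -!cost_widen; apply: h; rewrite avoids_widen.
move=> N kN; have [N' NE] := avoids_widen_ex kN; rewrite NE in kN *.
by rewrite !cost_widen; apply: h; rewrite -avoids_widen.
Qed.

Lemma optimum_widen k x :
  optimum (avoids b k) x = optimum (kmatching k) (x \o widen_edge).
Proof.
congr inf; apply/seteqP; split=> r [N kN <-].
  have [N' NE] := avoids_widen_ex kN; rewrite NE in kN *.
  by exists N'; [rewrite /= -avoids_widen|rewrite cost_widen].
by exists (widen_edge @: N); [rewrite /= avoids_widen|rewrite cost_widen].
Qed.
End restriction.

Local Open Scope classical_set_scope.
Local Open Scope ring_scope.

(** * Families of independent random variables *)

Definition cylinder (R : realType) (I : finType) (S : I -> set R) : set (I -> R) :=
  [set x | forall i, S i (x i)].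

(** Boxes are closed under intersection and include the whole space, so a probability measure on the
    generated sigma-algebra is determined by its values on them. *)
Definition cylinders (R : realType) (I : finType) : set (set (I -> R)) :=
  [set C | exists2 S : I -> set R, (forall i, measurable (S i)) & C = cylinder S].

Notation vec R I := (g_sigma_algebraType (@cylinders R I)).

Section vec.
Context (R : realType) (I : finType).

Lemma measurable_cylinder (S : I -> set R) :
  (forall i, measurable (S i)) -> measurable (cylinder S : set (vec R I)).
Proof. by move=> mS; apply: sub_sigma_algebra; exists S. Qed.

Lemma measurable_coord (i : I) : measurable_fun setT (fun x : vec R I => x i).
Proof.
move=> _ S mS; rewrite setTI.
have -> : (fun x : vec R I => x i) @^-1` S =
    cylinder (fun j => if j == i then S else setT).
  apply/seteqP; split => x /=.
    by move=> Sx j; case: eqP => // ->.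
  by move=> /(_ i); rewrite eqxx.
by apply: measurable_cylinder => j; case: ifP.
Qed.

Lemma measurable_vec d (T : measurableType d) (f : T -> vec R I) :
  (forall i, measurable_fun setT (fun w => f w i)) -> measurable_fun setT f.
Proof.
move=> mf; apply: measurability => //.
move=> _ [_ [S mS ->] <-]; rewrite setTI.
have -> : f @^-1` cylinder S = \bigcap_(i in [set: I]) ((fun w => f w i) @^-1` S i).
  by apply/seteqP; split => w /= h i => [_|]; exact: h.
apply: fin_bigcap_measurable => // i _.
by rewrite -[X in measurable X]setTI; exact: mf.
Qed.

Lemma cylinders_measure_unique (m1 m2 : {measure set (vec R I) -> \bar R}) :
  (m1 setT < +oo)%E ->
  (forall S : I -> set R, (forall i, measurable (S i)) ->
     m1 (cylinder S) = m2 (cylinder S)) ->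
  forall A : set (vec R I), measurable A -> m1 A = m2 A.
Proof.
move=> fin m12 A mA.
have cT : cylinder (fun _ : I => [set: R]) = setT by apply/seteqP; split.
apply: (@measure_unique _ R (vec R I) (@cylinders R I) (fun=> setT)) => //.
- move=> _ _ [S mS ->] [S' mS' ->]; exists (fun i => S i `&` S' i).
    by move=> i; exact: measurableI.
  apply/seteqP; split => x /=.
    by move=> [h h'] i; split; [exact: h|exact: h'].
  by move=> h; split=> i; have [] := h i.
- by move=> _; exists (fun=> setT).
- by rewrite bigcup_const.
- by move=> _ [S mS ->]; exact: m12.
Qed.
End vec.

(** The standing condition on integrands: it is stable under the operations used below, and for
    finite measures it implies integrability, as linearity and Fubini's theorem require. *)
Definition bounded_measurable (R : realType) d (T : measurableType d) (f : T -> R) :=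
  measurable_fun setT f /\ exists M : R, forall x, `|f x| <= M.

Section bounded_measurable.
Context (R : realType) d (T : measurableType d).
Implicit Types f g : T -> R.

Lemma bounded_measurableD f g : bounded_measurable f -> bounded_measurable g ->
  bounded_measurable (fun x => f x + g x).
Proof.
move=> [mf [M fM]] [mg [N gN]]; split; first exact: measurable_funD.
by exists (M + N) => x; rewrite (le_trans (ler_normD _ _))// lerD.
Qed.

Lemma bounded_measurableM f g : bounded_measurable f -> bounded_measurable g ->
  bounded_measurable (fun x => f x * g x).
Proof.
move=> [mf [M fM]] [mg [N gN]]; split; first exact: measurable_funM.
by exists (M * N) => x; rewrite normrM ler_pM.
Qed.

Lemma bounded_measurable_cst (r : R) : bounded_measurable (fun _ : T => r).
Proof. by split => //; exists `|r|. Qed.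

Lemma bounded_measurable_indic (A : set T) : measurable A ->
  bounded_measurable (\1_A : T -> R).
Proof.
move=> mA; split; first exact: measurable_indic.
by exists 1 => x; rewrite indicE; case: (_ \in _); rewrite ?normr1 ?normr0.
Qed.

Lemma bounded_measurable_sum (J : finType) (Q : pred J) (f : J -> T -> R) :
  (forall j, Q j -> bounded_measurable (f j)) ->
  bounded_measurable (fun x => \sum_(j | Q j) f j x).
Proof.
move=> bf; have -> : (fun x => \sum_(j | Q j) f j x) = \sum_(j | Q j) f j.
  by apply/funext => x; rewrite fct_sumE.
elim/big_ind : _ => //; first exact: bounded_measurable_cst.
exact: bounded_measurableD.
Qed.

Lemma bounded_measurable_comp d' (U : measurableType d') (g : U -> T) f :
  bounded_measurable f -> measurable_fun setT g ->
  bounded_measurable (fun x => f (g x)).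
Proof.
move=> [mf [M fM]] mg; split; first exact: measurableT_comp.
by exists M.
Qed.

Lemma bounded_measurable_integrable (P : {measure set T -> \bar R}) f :
  (P setT < +oo)%E -> bounded_measurable f -> P.-integrable setT (EFin \o f).
Proof.
move=> Poo [mf [M fM]]; apply: measurable_bounded_integrable => //.
by exists M; split; [exact: num_real|move=> N MN x _ /=; exact: le_trans (ltW MN)].
Qed.
End bounded_measurable.

(** * Product laws and resampling of one coordinate *)

Section law.
Context (R : realType) (I : finType) (mu : I -> probability R R).

(** [P] is only assumed to be a measure so that the notion also covers [P \x mu e]; total mass 1 is
    a consequence. *)
Definition has_product_law d (T : measurableType d) (P : {measure set T -> \bar R})
    (V : T -> vec R I) :=
  measurable_fun setT V /\
  forall S : I -> set R, (forall i, measurable (S i)) ->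
    P (V @^-1` cylinder S) = (\prod_i mu i (S i))%E.

Lemma has_product_law_setT d (T : measurableType d) (P : {measure set T -> \bar R})
    (V : T -> vec R I) : has_product_law P V -> P setT = 1%E.
Proof.
move=> [_ /(_ (fun=> setT))]; rewrite big1; last by move=> i _; exact: probability_setT.
by move=> <- //; congr (P _); apply/seteqP; split.
Qed.

(** Expectations can thus be compared across probability spaces: with the space enlarged by a fresh
    coordinate, and between the graph with a column deleted and the smaller graph, whose costs live
    elsewhere. *)
Lemma Rintegral_product_law d (T : measurableType d) (P : {measure set T -> \bar R})
    (V : T -> vec R I) d' (T' : measurableType d') (P' : {measure set T' -> \bar R})
    (V' : T' -> vec R I) (F : vec R I -> R) :
  has_product_law P V -> has_product_law P' V' -> bounded_measurable F ->
  \int[P]_w F (V w) = \int[P']_w F (V' w).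
Proof.
move=> PV PV' bF; congr fine.
have key d0 (T0 : measurableType d0) (P0 : {measure set T0 -> \bar R})
    (V0 : T0 -> vec R I) : has_product_law P0 V0 ->
    (\int[P0]_w (F (V0 w))%:E = \int[pushforward P0 V0]_x (F x)%:E)%E.
  move=> PV0; rewrite [RHS]integral_pushforward//=.
  - by case: PV0.
  - by apply/measurable_EFinP; case: bF.
  - rewrite preimage_setT; apply: (@bounded_measurable_integrable _ _ _ P0 (F \o V0)).
      by rewrite (has_product_law_setT PV0) ltry.
    by apply: bounded_measurable_comp => //; case: PV0.
rewrite (key _ _ _ _ PV) (key _ _ _ _ PV').
have [mV PVE] := PV; have [mV' PVE'] := PV'.
pose m1 := measure_function_pushforward__canonical__measure_function_Measure P mV.
pose m2 := measure_function_pushforward__canonical__measure_function_Measure P' mV'.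
apply: (@eq_measure_integral _ _ _ _ m2 m1) => A mA _.
apply: cylinders_measure_unique => //.
  by rewrite /m1 /= /pushforward preimage_setT (has_product_law_setT PV) ltry.
by move=> S mS; rewrite /m1 /m2 /= /pushforward PVE// PVE'.
Qed.

Lemma measurable_upd d (T : measurableType d) (V : T -> vec R I) (Z : T -> R) e :
  measurable_fun setT V -> measurable_fun setT Z ->
  measurable_fun setT (fun w => upd (V w) e (Z w) : vec R I).
Proof.
move=> mV mZ; apply: measurable_vec => i; rewrite /upd; case: eqP => // _.
exact: (measurableT_comp (measurable_coord i) mV).
Qed.

Lemma resample_law d (T : measurableType d) (P : {sigma_finite_measure set T -> \bar R})
    (V : T -> vec R I) (e : I) :
  has_product_law P V ->
  has_product_law (P \x mu e)%E (fun p : T * R => upd (V p.1) e p.2 : vec R I).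
Proof.
move=> PV; have [mV PVE] := PV; split.
  apply: measurable_upd; last exact: measurable_snd.
  exact: measurableT_comp.
(* The old coordinate [e] becomes unconstrained, which frees a factor 1 in the product; the fresh
   coordinate carries [S e] instead. *)
move=> S mS; pose S' i := if i == e then setT else S i.
have mS' i : measurable (S' i) by rewrite /S'; case: ifP.
have -> : (fun p : T * R => upd (V p.1) e p.2) @^-1` cylinder S =
    (V @^-1` cylinder S') `*` S e.
  apply/seteqP; split => -[w z] /=.
    move=> h; split; last by have := h e; rewrite /upd eqxx.
    by move=> i; rewrite /S'; have := h i; rewrite /upd; case: ifP.
  by move=> [h Sz] i; have := h i; rewrite /S' /upd; case: eqP => [->|].
have mVS : measurable (V @^-1` cylinder S').
  by rewrite -[X in measurable X]setTI; apply: mV => //; exact: measurable_cylinder.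
apply: etrans (product_measure1E P (mu e) mVS (mS e)) _.
rewrite PVE// [in RHS](bigD1 e)//= [in LHS](bigD1 e)//= {1}/S' eqxx.
rewrite probability_setT mul1e muleC; congr (_ * _)%E.
by apply: eq_bigr => i /negPf ie; rewrite /S' ie.
Qed.

(** This replaces conditioning on all costs but that of [e]: putting an independent copy in place of
    the coordinate preserves the law, and Fubini's theorem isolates the copy. *)
Lemma resample d (T : measurableType d) (P : probability T R)
    (V : T -> vec R I) (e : I) (F : vec R I -> R) :
  has_product_law P V -> bounded_measurable F ->
  \int[P]_w F (V w) = \int[P]_w \int[mu e]_z F (upd (V w) e z).
Proof.
move=> PV bF; have PV' := resample_law e PV.
rewrite (Rintegral_product_law PV PV' bF); congr fine.
have bG : bounded_measurable (fun p : T * R => F (upd (V p.1) e p.2)).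
  by apply: (bounded_measurable_comp bF); case: PV'.
rewrite -[in LHS]integral12_prod_meas1; last first.
  by apply: bounded_measurable_integrable => //; rewrite (has_product_law_setT PV') ltry.
apply: eq_integral => w _; rewrite /fubini_F /= /Rintegral fineK//.
apply: integrable_fin_num => //.
apply: bounded_measurable_integrable.
  by rewrite [X in (X < _)%E]probability_setT ltry.
by apply: (bounded_measurable_comp bF); apply: measurable_upd => //; exact: measurable_cst.
Qed.
End law.

Section almost_everywhere.
Context (R : realType) d (T : measurableType d) (P : probability T R).

Lemma Rintegral_bounded_integrable (f : T -> R) :
  bounded_measurable f -> P.-integrable setT (EFin \o f).
Proof. by apply: bounded_measurable_integrable; rewrite [X in (X < _)%E](probability_setT P) ltry. Qed.

Lemma ae_eq_Rintegral (f g : T -> R) : bounded_measurable f -> bounded_measurable g ->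
  {ae P, forall w, f w = g w} -> \int[P]_w f w = \int[P]_w g w.
Proof.
move=> [mf _] [mg _] fg; congr fine; apply: ae_eq_integral => //.
- exact/measurable_EFinP.
- exact/measurable_EFinP.
- by apply: filterS fg => w /= ->.
Qed.

Lemma Rintegral_fsum (J : finType) (Q : pred J) (f : J -> T -> R) :
  (forall j, bounded_measurable (f j)) ->
  \int[P]_w (\sum_(j | Q j) f j w) = \sum_(j | Q j) \int[P]_w f j w.
Proof.
move=> bf; have -> : (fun w => \sum_(j | Q j) f j w) = \sum_(j | Q j) f j.
  by apply/funext => w; rewrite fct_sumE.
suff [] : bounded_measurable (\sum_(j | Q j) f j) /\
  \int[P]_w (\sum_(j | Q j) f j) w = \sum_(j | Q j) \int[P]_w f j w by [].
elim/big_ind2 : _ => [|F a G c [bF <-] [bG <-]|//].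
  by split; [exact: bounded_measurable_cst|rewrite Rintegral_cst// mul0r].
split; first exact: bounded_measurableD.
by rewrite -RintegralD//; exact: Rintegral_bounded_integrable.
Qed.
End almost_everywhere.

Section resampling.
Context (R : realType) (I : finType) (mu : I -> probability R R).
Context d (T : measurableType d) (P : probability T R) (V : T -> vec R I).
Hypothesis PV : has_product_law mu P V.
Implicit Types (F : vec R I -> R) (e : I).

Lemma bounded_measurable_resample F e : bounded_measurable F ->
  bounded_measurable (fun x : vec R I => \int[mu e]_z F (upd x e z)).
Proof.
move=> bF; have [_ [M FM]] := bF.
(* Measurability of the inner integral comes from Fubini's theorem, for which
   any probability measure on the first factor will do. *)
pose D : probability (vec R I) R := @dirac _ (vec R I) (fun=> 0 : R) R.
have bG : bounded_measurable (fun p : vec R I * R => F (upd p.1 e p.2)).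
  by apply: (bounded_measurable_comp bF); apply: measurable_upd.
have iG : (D \x mu e)%E.-integrable setT
    (fun p : vec R I * R => (F (upd p.1 e p.2))%:E).
  apply: bounded_measurable_integrable => //.
  have -> : [set: vec R I * R] = setT `*` setT by apply/seteqP; split.
  rewrite [X in (X < _)%E](product_measure1E D (mu e) measurableT measurableT).
  by rewrite [X in (X * _)%E](probability_setT D) [X in (_ * X)%E](probability_setT (mu e)) mule1 ltry.
have Fx x : bounded_measurable (fun z : R => F (upd x e z)).
  apply: (bounded_measurable_comp bF); apply: measurable_upd => //; exact: measurable_cst.
split.
  apply/measurable_EFinP.
  have := measurable_fubini_F iG; congr (measurable_fun _ _).
  apply/funext => x; rewrite /fubini_F /= /Rintegral fineK//.
  by apply: integrable_fin_num => //; exact: Rintegral_bounded_integrable.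
exists M => x; apply: (le_trans (le_normr_Rintegral _ _)) => //.
  exact: Rintegral_bounded_integrable.
apply: (@le_trans _ _ (\int[mu e]_z M)).
  apply: le_Rintegral => //.
  - apply: Rintegral_bounded_integrable; split; last by exists M => z; rewrite normr_id.
    by apply: measurableT_comp => //; case: (Fx x).
  - by apply: Rintegral_bounded_integrable; exact: bounded_measurable_cst.
rewrite Rintegral_cst//.
by have /= -> := probability_setT (mu e); rewrite mulr1.
Qed.

Lemma bounded_measurable_law F : bounded_measurable F -> bounded_measurable (F \o V).
Proof. by move=> bF; apply: (bounded_measurable_comp bF); case: PV. Qed.

Lemma resample_ae F1 F2 e : bounded_measurable F1 -> bounded_measurable F2 ->
  {ae P, forall w, \int[mu e]_z F1 (upd (V w) e z) = \int[mu e]_z F2 (upd (V w) e z)} ->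
  \int[P]_w F1 (V w) = \int[P]_w F2 (V w).
Proof.
move=> b1 b2 h; rewrite (resample e PV b1) (resample e PV b2).
apply: ae_eq_Rintegral => //; apply: bounded_measurable_law (bounded_measurable_resample _ _) => //.
Qed.

Lemma resample_negligible (A : set (vec R I)) e : measurable A ->
  (forall x, mu e [set z | A (upd x e z)] = 0%E) -> {ae P, forall w, ~ A (V w)}.
Proof.
move=> mA h.
have mVA : measurable (V @^-1` A) by rewrite -[X in measurable X]setTI; case: PV => mV _; exact: mV.
have PA : P (V @^-1` A) = 0%E.
  have bA := bounded_measurable_indic R mA.
  have := resample e PV bA.
  have -> : (fun w => \1_A (V w)) = (\1_(V @^-1` A) : T -> R).
    by apply/funext => w; rewrite !indicE; congr (_%:R); apply/idP/idP => /set_mem ?; exact/mem_set.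
  have -> : \int[P]_w \1_(V @^-1` A) w = fine (P (V @^-1` A)).
    by rewrite /Rintegral integral_indic// setIT.
  have -> : \int[P]_w \int[mu e]_z \1_A (upd (V w) e z) = 0.
    have -> : (fun w => \int[mu e]_z \1_A (upd (V w) e z)) = cst (0 : R).
      apply/funext => w.
      have mAw : measurable [set z | A (upd (V w) e z)].
        have mup : measurable_fun setT (fun z : R => upd (V w) e z : vec R I).
          by apply: measurable_upd => //; exact: measurable_cst.
        by have := mup measurableT _ mA; rewrite setTI.
      transitivity (\int[mu e]_z \1_[set z | A (upd (V w) e z)] z).
        apply: eq_Rintegral => z _; rewrite !indicE; congr (_%:R).
      by rewrite /Rintegral integral_indic// setIT [X in fine X]h.
    by rewrite Rintegral_cst// mul0r.
  move=> PA; rewrite -[LHS]fineK ?PA//.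
  by rewrite fin_num_measure.
exists (V @^-1` A); split => //.
by move=> w /= /contrapT.
Qed.

Lemma coordinate_negligible (S : set R) e : measurable S -> mu e S = 0%E ->
  {ae P, forall w, ~ S (V w e)}.
Proof.
move=> mS S0; apply: (@resample_negligible [set x | S (x e)] e).
  by have := @measurable_coord R I e measurableT S mS; rewrite setTI.
by move=> x; rewrite -S0; congr (mu e _); apply/funext => z; rewrite /= /upd eqxx.
Qed.
End resampling.

(** * Exponential laws *)

Section exponential_law.
Context (R : realType) (r : R) (r0 : 0 < r).
Local Notation leb := (@lebesgue_measure R).

(* The library's [exponential_prob] is a measure on another copy of the Borel
   space, with a different display. *)
Definition exponential_law_fun (_ : 0 < r) : set R -> \bar R := exponential_prob r.

Let E := exponential_distribution_exponential_prob__canonical__probability_measure_Probability r0.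

HB.instance Definition _ := isMeasure.Build _ R R (exponential_law_fun r0)
  (@measure0 _ _ _ E) (@measure_ge0 _ _ _ E) (@measure_semi_sigma_additive _ _ _ E).

HB.instance Definition _ :=
  @Measure_isProbability.Build _ R R (exponential_law_fun r0) (@probability_setT _ _ _ E).

Definition exponential_law : probability R R := exponential_law_fun r0.

Lemma exponential_law_dominates : E `<< leb.
Proof.
apply/null_content_dominatesP => A mA muA0; rewrite /= /exponential_prob.
by apply: null_set_integral => //=; apply/measurable_EFinP/measurable_funTS;
  exact: measurable_exponential_pdf.
Qed.

Lemma Rintegral_exponential_law (f : R -> R) : bounded_measurable f ->
  \int[exponential_law]_x f x = \int[leb]_x (f x * exponential_pdf r x).
Proof.
move=> bf; congr fine.
pose T : measurableType _ := g_sigma_algebraType (R.-ocitv.-measurable).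
pose E0 : probability T R := E.
have domE : E0 `<< leb := exponential_law_dominates.
have mid : @measurable_fun _ _ R T setT id by [].
have bfT : @bounded_measurable R _ T f by [].
have mf : @measurable_fun _ _ T _ setT (EFin \o f).
  by apply/measurable_EFinP; case: bfT.
(* The identity map transports the integral to the copy of the Borel space on which the
   Radon-Nikodym theorem is applied. *)
transitivity (\int[E0]_x (f x)%:E)%E.
  have /(_ mid exponential_law setT (EFin \o f) mf) := @integral_pushforward _ _ R T R id.
  move=> <- //=.
  apply: bounded_measurable_integrable => //.
  by rewrite [X in (X < _)%E](probability_setT exponential_law) ltry.
have mpdf : @measurable_fun _ _ T _ setT (EFin \o exponential_pdf r).
  by apply/measurable_EFinP; exact: measurable_exponential_pdf.
have iE : E0.-integrable setT (EFin \o f).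
  apply: bounded_measurable_integrable => //.
  by rewrite [X in (X < _)%E](probability_setT E0) ltry.
have := @Radon_Nikodym_change_of_variables _ T R E0 leb domE (EFin \o f) setT measurableT iE.
rewrite /= => <-.
under [RHS]eq_integral do rewrite EFinM.
have iRN := @Radon_Nikodym_integrable _ T R (charge_of_finite_measure E0) leb domE.
apply: ae_eq_integral => //.
- apply: emeasurable_funM => //; apply: (measurable_int leb); exact: iRN.
- exact: emeasurable_funM.
- apply: ae_eqe_mul2l => /=.
  (* The Radon-Nikodym derivative and the explicit density have the same integral over every
     measurable set, hence agree almost everywhere. *)
  apply: integral_ae_eq => //=.
  by move=> A _ mA; rewrite -(@Radon_Nikodym_integral _ T R (charge_of_finite_measure E0) leb A domE mA).
Qed.

Lemma exponential_law_set1 (x : R) : exponential_law [set x] = 0%E.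
Proof.
rewrite /= /exponential_law_fun /exponential_prob.
apply: null_set_integral => //=; last by rewrite lebesgue_measure_set1.
by apply/measurable_EFinP/measurable_funTS; exact: measurable_exponential_pdf.
Qed.

Lemma exponential_law_itv0c (x : R) : 0 <= x ->
  exponential_law `[0, x]%classic = (1 - expR (- r * x))%:E.
Proof.
rewrite le_eqVlt => /predU1P[<-|x0].
  by rewrite mulr0 expR0 subrr set_itv1 exponential_law_set1.
by rewrite EFinB; exact: exponential_prob_itv0c.
Qed.

Lemma exponential_law_lt0 : exponential_law [set z | z < 0] = 0%E.
Proof.
rewrite /= /exponential_law_fun /exponential_prob integral0_eq// => z /= z0.
by rewrite lt0_exponential_pdf.
Qed.

Lemma measurable_ray (x : R) : measurable [set z : R | x < z].
Proof. by rewrite -[X in measurable X]set_itvoy//; exact: measurable_itv. Qed.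

Lemma exponential_law_gt (x : R) : 0 <= x ->
  exponential_law [set z | x < z] = (expR (- r * x))%:E.
Proof.
move=> x0.
have -> : [set z : R | x < z] = ~` ([set z | z < 0] `|` `[0, x]%classic).
  apply/seteqP; split => z /=; rewrite in_itv/=.
    move=> xz [|/andP[_]]; first by rewrite ltNge (le_trans x0 (ltW xz)).
    by rewrite leNgt xz.
  - by move=> /not_orP[/negP]; rewrite -leNgt => -> /negP; rewrite -ltNge.
have mN : measurable [set z : R | z < 0].
  by rewrite -[X in measurable X]set_itvNyo//; exact: measurable_itv.
rewrite probability_setC; last exact: measurableU.
rewrite measureU//; last first.
  apply/seteqP; split => // z /= [z0]; rewrite in_itv/= => /andP[+ _].
  by rewrite leNgt z0.
rewrite [X in (_ - (X + _))%E]exponential_law_lt0 add0e.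
by rewrite [X in (_ - X)%E]exponential_law_itv0c// -EFinB; congr (_%:E); ring.
Qed.

Lemma exponential_law_ge (x : R) : 0 <= x ->
  exponential_law [set z | x <= z] = (expR (- r * x))%:E.
Proof.
move=> x0; rewrite -exponential_law_gt//.
have -> : [set z : R | x <= z] = [set x] `|` [set z | x < z].
  apply/seteqP; split => z /=; first by rewrite le_eqVlt => /predU1P[|]; [left|right].
  by move=> [->//|/ltW].
rewrite measureU//; last first.
- by apply/seteqP; split => [z /= [-> xx]|//]; rewrite ltxx in xx.
- exact: measurable_ray.
by rewrite [X in (X + _)%E]exponential_law_set1 add0e.
Qed.

Lemma Rintegral_exponential_law_indic (A : set R) : measurable A ->
  \int[exponential_law]_z \1_A z = fine (exponential_law A).
Proof. by move=> mA; rewrite /Rintegral integral_indic// setIT. Qed.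

End exponential_law.

Section exponential_law2.
Context (R : realType) (r : R) (r0 : 0 < r).
Local Notation leb := (@lebesgue_measure R).
(** On [z >= 0] the integrand times the density has the primitive
    [r * (phi (y + z) * expR (- r * z))]. The maxima with 0 have no effect there and only keep the
    integrand bounded on the negative half-line, which has mass zero. *)
Lemma exponential_law_by_parts (phi phi' : R -> R) (y W : R) :
  0 <= y -> 0 <= W -> (forall x : R, is_derive x 1 phi (phi' x)) ->
  continuous phi' ->
  bounded_measurable (fun x : R => phi (Num.max x 0)) ->
  bounded_measurable (fun x : R => phi' (Num.max x 0)) ->
  \int[exponential_law r0]_z
     ((phi' (Num.max (y + z) 0) - r * phi (Num.max (y + z) 0)) * \1_[set z | z <= W] z) =
  r * (phi (y + W) * expR (- r * W) - phi y).
Proof.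
move=> y0 W0 dphi cphi' bphi bphi'.
have myz : measurable_fun setT (fun z : R => y + z) by exact: measurable_funD.
have m1 : measurable [set z : R | z <= W].
  by rewrite -[X in measurable X]set_itvNyc//; exact: measurable_itv.
have b1 := bounded_measurable_comp bphi myz.
have b2 := bounded_measurable_comp bphi' myz.
rewrite (Rintegral_exponential_law r0); last first.
  apply: bounded_measurableM; last exact: bounded_measurable_indic.
  apply: bounded_measurableD => //.
  have -> : (fun x => - (r * phi (Num.max (y + x) 0))) =
            (fun x => (- r) * phi (Num.max (y + x) 0)).
    by apply/funext => x; rewrite mulNr.
  by apply: bounded_measurableM => //; exact: bounded_measurable_cst.
pose G z := r * (phi (y + z) * expR (- r * z)).
pose g z := (phi' (y + z) - r * phi (y + z)) * (r * expR (- r * z)).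
transitivity (\int[leb]_(z in `[0, W]) g z).
  rewrite [RHS]Rintegral_mkcond; apply: eq_Rintegral => z _.
  have mW : (z \in [set z | z <= W]) = (z <= W) by apply/idP/idP => [/set_mem|/mem_set].
  rewrite patchE indicE mW /exponential_pdf patchE !mem_setE !in_itv/= andbT.
  have [z0|z0] := leP 0 z; last by rewrite mulr0.
  case: (z <= W); rewrite /= ?(mulr0, mul0r, mulr1)//.
  by rewrite max_l ?addr_ge0//.
have dexp (z : R) : is_derive z 1 (fun z : R => expR (- r * z)) (- r * expR (- r * z)).
  have h := @is_derive1_comp _ expR (fun z : R => - r * z) z (expR (- r * z)) (- r) _ _.
  apply: is_derive_eq (h _ _) _; last by rewrite mulrC.
  have h1 := @is_deriveZ _ R R id (- r) z 1 1 _.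
  by apply: is_derive_eq (h1 _) _; rewrite [LHS]mulr1.
have dshift (z : R) : is_derive z 1 (fun z : R => phi (y + z)) (phi' (y + z)).
  have h := @is_derive1_comp _ phi (fun z : R => y + z) z (phi' (y + z)) 1 (dphi _).
  apply: is_derive_eq (h _) _; last by rewrite mulr1.
  have h1 := @is_deriveD _ R R (cst y) id z 1 0 1 _ _.
  exact: (is_derive_eq (h1 (is_derive_cst _ _ _) (is_derive_id _ _)) (add0r 1)).
have dG (z : R) : is_derive z 1 G (g z).
  have h := @is_deriveM _ _ _ _ z 1 _ _ (dshift z) (dexp z).
  have h2 := is_deriveZ r h.
  apply: is_derive_eq h2 _; rewrite /g /=.
  by rewrite /GRing.scale /=; ring.
have cphi (z : R) : {for z, continuous phi}.
  by apply/differentiable_continuous/derivable1_diffP; case: (dphi z).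
have cexp (z : R) : {for z, continuous (fun z : R => expR (- r * z))}.
  by apply/differentiable_continuous/derivable1_diffP; case: (dexp z).
have cG (z : R) : {for z, continuous G}.
  by apply/differentiable_continuous/derivable1_diffP; case: (dG z).
have cg : continuous g.
  move=> z; rewrite /g.
  have cyz : {for z, continuous (fun z : R => y + z)}.
    by apply: cvgD; [exact: cvg_cst|exact: cvg_id].
  apply: cvgM.
    apply: cvgB.
      by apply: (continuous_comp cyz); exact: cphi'.
    apply: cvgM; first exact: cvg_cst.
    by apply: (continuous_comp cyz); exact: cphi.
  apply: cvgM; first exact: cvg_cst.
  exact: cexp.
move: W0; rewrite le_eqVlt => /predU1P[<-|W0].
  by rewrite set_itv1 Rintegral_set1 addr0 mulr0 expR0 mulr1 subrr mulr0.
rewrite /Rintegral (@continuous_FTC2 _ g G)//=; first last.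
- by move=> z _; rewrite derive1E; exact: derive_val.
- split.
  + by move=> z _; case: (dG z).
  + exact/cvg_at_right_filter/cG.
  + exact/cvg_at_left_filter/cG.
- exact: continuous_subspaceT.
by rewrite /G addr0 mulr0 expR0; ring.
Qed.

(** On the event [X < y + z] the integrand is the constant [phi X], and its contribution cancels the
    upper boundary term of the integration by parts with [W = X - y]. *)
Lemma Rintegral_exponential_law_min (phi phi' : R -> R) (y X : R) :
  0 <= y -> y <= X -> (forall x : R, is_derive x 1 phi (phi' x)) ->
  continuous phi' ->
  bounded_measurable (fun x : R => phi (Num.max x 0)) ->
  bounded_measurable (fun x : R => phi' (Num.max x 0)) ->
  \int[exponential_law r0]_z phi (Num.max (Num.min X (y + z)) 0) =
  phi y + r^-1 * \int[exponential_law r0]_z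
     (phi' (Num.max (y + z) 0) * \1_[set z | y + z <= X] z).
Proof.
move=> y0 yX dphi cphi' bphi bphi'.
have W0 : 0 <= X - y by rewrite subr_ge0.
have := exponential_law_by_parts y0 W0 dphi cphi' bphi bphi'.
have -> : [set z | z <= X - y] = [set z | y + z <= X].
  by apply/funext => z /=; rewrite lerBrDl.
rewrite subrKC => byp.
have my : measurable_fun setT (fun z : R => y + z) by exact: measurable_funD.
have m1 : measurable [set z : R | y + z <= X].
  rewrite -[X in measurable X]setTI.
  exact: (measurable_fun_ler my (measurable_cst X)).
have m2 : measurable [set z : R | X - y < z] by exact: measurable_ray.
have b1 := bounded_measurable_indic R m1.
have b2 := bounded_measurable_indic R m2.
have bp := bounded_measurable_comp bphi my.
have bp' := bounded_measurable_comp bphi' my.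
have bI f : bounded_measurable f -> (exponential_law r0).-integrable setT (EFin \o f).
  apply: bounded_measurable_integrable.
  by rewrite [X in (X < _)%E](probability_setT (exponential_law r0)) ltry.
have bc c := bounded_measurable_cst R c.
transitivity (\int[exponential_law r0]_z (phi (Num.max (y + z) 0) * \1_[set z | y + z <= X] z
   + phi X * \1_[set z | X - y < z] z)).
  apply: eq_Rintegral => z _; rewrite !indicE.
  have -> : (z \in [set z | y + z <= X]) = (y + z <= X) by apply/idP/idP => [/set_mem|/mem_set].
  have -> : (z \in [set z | X - y < z]) = (X < y + z).
    by rewrite -ltrBlDl; apply/idP/idP => [/set_mem|/mem_set].
  have [yzX|yzX] := leP (y + z) X; first by rewrite mulr1 mulr0 addr0.
  by rewrite mulr0 mulr1 add0r max_l// (le_trans y0).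
rewrite RintegralD//; last first.
- by apply: bI; exact: bounded_measurableM.
- by apply: bI; exact: bounded_measurableM.
rewrite RintegralZl//; last exact: bI.
rewrite Rintegral_exponential_law_indic// [X in fine X]exponential_law_gt//=.
move: byp; under eq_Rintegral do rewrite mulrBl -mulrA.
rewrite RintegralB//; last first.
- by apply/bI/bounded_measurableM => //; exact: bounded_measurableM.
- by apply/bI; exact: bounded_measurableM.
rewrite RintegralZl//; last by apply/bI; exact: bounded_measurableM.
set A := \int[_]_z _; set B := \int[_]_z _ => byp.
have r_neq0 : r != 0 by rewrite gt_eqF.
have -> : A = r * B + r * (phi X * expR (- r * (X - y)) - phi y) by rewrite -byp; ring.
by field.
Qed.
End exponential_law2.

(** The maximum is there because [z] will be the outer variable of an iterated integral and ranges
    over the whole line. *)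
Lemma Rintegral_exponential_law_tail (R : realType) (s : R) (s0 : 0 < s) (z : R) :
  \int[exponential_law s0]_v \1_[set v | z <= v] v = expR (- s * Num.max z 0).
Proof.
have mz : measurable [set v | z <= v].
  by rewrite -[X in measurable X]set_itvcy//; exact: measurable_itv.
rewrite Rintegral_exponential_law_indic//.
have [z0|/ltW z0] := leP 0 z; first by rewrite [X in fine X]exponential_law_ge.
rewrite mulr0 expR0.
suff -> : exponential_law s0 [set v | z <= v] = 1%E by [].
apply/eqP; rewrite eq_le probability_le1//=.
have <- : exponential_law s0 [set v | 0 <= v] = 1%E.
  by rewrite [LHS]exponential_law_ge// mulr0 expR0.
rewrite le_measure ?inE//.
  by rewrite -[X in measurable X]set_itvcy//; exact: measurable_itv.
by move=> v /=; exact: le_trans.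
Qed.

(** Both sides are the integral over [z >= 0] of [f z] times r s exp(-(r+s)z). In other words, which
    clock rings first is independent of the time at which it rings. *)
Lemma competing_exponentials (R : realType) (r s : R) (r0 : 0 < r) (s0 : 0 < s)
    (f : R -> R) : bounded_measurable f ->
  s * \int[exponential_law r0]_z \int[exponential_law s0]_v
        (f z * \1_[set v | z <= v] v) =
  r * \int[exponential_law s0]_v \int[exponential_law r0]_z
        (f v * \1_[set z | v <= z] z).
Proof.
move=> bf.
have bI (q : R) (q0 : 0 < q) (g : R -> R) : bounded_measurable g ->
    (exponential_law q0).-integrable setT (EFin \o g).
  apply: bounded_measurable_integrable.
  by rewrite [X in (X < _)%E](probability_setT (exponential_law q0)) ltry.
have inner (q : R) (q0 : 0 < q) z :
    \int[exponential_law q0]_v (f z * \1_[set v | z <= v] v) =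
    f z * expR (- q * Num.max z 0).
  rewrite RintegralZl ?Rintegral_exponential_law_tail//.
  apply/bI/bounded_measurable_indic.
  by rewrite -[X in measurable X]set_itvcy//; exact: measurable_itv.
have bE (q : R) : 0 < q -> bounded_measurable (fun z : R => f z * expR (- q * Num.max z 0)).
  move=> q0; apply: bounded_measurableM => //; split.
    apply: measurableT_comp => //; apply: measurable_funM => //.
    exact: measurable_maxr.
  exists 1 => z; rewrite ger0_norm ?expR_ge0// -[leRHS]expR0 ler_expR.
  by rewrite mulNr oppr_le0 mulr_ge0 ?(ltW q0)// le_max lexx orbT.
under eq_Rintegral do rewrite inner.
under [in RHS]eq_Rintegral do rewrite inner.
have Zl (q c : R) (q0 : 0 < q) (g : R -> R) : bounded_measurable g ->
    c * \int[exponential_law q0]_z g z = \int[exponential_law q0]_z (c * g z).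
  by move=> bg; rewrite RintegralZl//; exact: bI.
rewrite (Zl _ _ r0 _ (bE _ s0)) (Zl _ _ s0 _ (bE _ r0)).
rewrite !Rintegral_exponential_law; last 2 first.
- by apply: bounded_measurableM; [exact: bounded_measurable_cst|exact: bE].
- by apply: bounded_measurableM; [exact: bounded_measurable_cst|exact: bE].
apply: eq_Rintegral => z _; rewrite /exponential_pdf !patchE mem_setE in_itv/= andbT.
have [z0|_] := leP 0 z; last by rewrite !mulr0.
by ring.
Qed.

(** * Minimum cost matchings with random costs *)

Section measurable_matchings.
Context (R : realType) (E : finType).
Implicit Types (M N : {set E}) (F : pred {set E}).
Local Notation vecE := (vec R E).

Lemma measurable_cost M : measurable_fun setT (fun x : vecE => cost x M).
Proof.
rewrite /cost; have -> : (fun x : vecE => \sum_(e in M) x e) =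
    (fun x : vecE => \sum_(e <- enum M) x e).
  by apply/funext => x; rewrite big_enum.
elim: (enum M) => [|e s IH].
  have -> : (fun x : vecE => \sum_(e <- [::]) x e) = cst 0.
    by apply/funext => x; rewrite big_nil.
  exact: measurable_cst.
have -> : (fun x : vecE => \sum_(i <- e :: s) x i) =
    (fun x : vecE => x e + \sum_(i <- s) x i).
  by apply/funext => x; rewrite big_cons.
by apply: measurable_funD => //; exact: measurable_coord.
Qed.

Lemma measurable_optimal F M : measurable [set x : vecE | optimal F x M].
Proof.
have [FM|FM] := boolP (F M); last first.
  rewrite [X in measurable X](_ : _ = set0)//; apply/seteqP; split=> // x /=.
  by rewrite /optimal (negPf FM).
rewrite [X in measurable X](_ : _ =
    \bigcap_(N in [set N | F N]) [set x : vecE | cost x M <= cost x N]).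
  apply: fin_bigcap_measurable => // N _; rewrite -[X in measurable X]setTI.
  exact: (measurable_fun_ler (measurable_cost M) (measurable_cost N)).
apply/seteqP; split=> x /=; first by move=> /optimalP[_ h] N; exact: h.
by move=> h; apply/optimalP; split=> // N FN; exact: h.
Qed.

Lemma measurable_optimum F : measurable_fun setT (fun x : vecE => optimum F x).
Proof.
have [[M0 FM0]|noF] := pselect (exists M, F M); last first.
  have -> : (fun x : vecE => optimum F x) = cst (inf set0).
    apply/funext => x; congr inf; apply/seteqP; split=> // r [M FM _].
    by apply: noF; exists M.
  exact: measurable_cst.
move=> _ S mS; rewrite setTI.
rewrite [X in measurable X](_ : _ = \bigcup_(M in [set M | F M])
    ([set x : vecE | optimal F x M] `&` (fun x => cost x M) @^-1` S)).
  apply: fin_bigcup_measurable => // M _; apply: measurableI; first exact: measurable_optimal.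
  by rewrite -[X in measurable X]setTI; exact: measurable_cost.
apply/seteqP; split=> x /=.
  have [M oM] := optimal_exists x FM0; rewrite (optimum_optimal oM) => SM.
  by exists M => //=; have /optimalP[] := oM.
by move=> [M _ [/= oM]]; rewrite (optimum_optimal oM).
Qed.

Definition optimal_event F (Q : pred {set E}) : set vecE :=
  [set x | exists M, optimal F x M && Q M].

Lemma measurable_optimal_event F Q : measurable (optimal_event F Q).
Proof.
rewrite [X in measurable X](_ : _ = \bigcup_(M in [set M | Q M]) [set x : vecE | optimal F x M]).
  by apply: fin_bigcup_measurable => // M _; exact: measurable_optimal.
apply/seteqP; split=> x /=; first by move=> [M /andP[oM QM]]; exists M.
by move=> [M QM oM]; exists M; apply/andP.
Qed.

Lemma bounded_measurable_optimal F M :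
  bounded_measurable (fun x : vecE => (optimal F x M)%:R : R).
Proof.
have -> : (fun x : vecE => (optimal F x M)%:R : R) = \1_[set x : vecE | optimal F x M].
  by apply/funext => x; rewrite indicE; congr ((nat_of_bool _)%:R); apply/idP/idP => [/mem_set|/set_mem].
by apply: bounded_measurable_indic; exact: measurable_optimal.
Qed.

Lemma indic_optimal_event x F Q M : injective (cost x) -> optimal F x M ->
  \1_(optimal_event F Q) x = (Q M)%:R :> R.
Proof.
move=> inj oM; rewrite indicE; congr ((nat_of_bool _)%:R); apply/idP/idP.
  by move=> /set_mem[N /andP[oN]]; rewrite (optimal_unique inj oM oN).
by move=> QM; apply/mem_set; exists M; rewrite oM.
Qed.

Lemma bounded_measurable_cost (psi : R -> R) M : bounded_measurable psi ->
  bounded_measurable (fun x : vecE => psi (cost x M)).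
Proof. by move=> b; apply: (bounded_measurable_comp b); exact: measurable_cost. Qed.

Lemma bounded_measurable_optimum (psi : R -> R) F : bounded_measurable psi ->
  bounded_measurable (fun x : vecE => psi (optimum F x)).
Proof. by move=> b; apply: (bounded_measurable_comp b); exact: measurable_optimum. Qed.

Lemma bounded_measurable_optimal_event F Q :
  bounded_measurable (fun x : vecE => \1_(optimal_event F Q) x : R).
Proof. by apply: bounded_measurable_indic; exact: measurable_optimal_event. Qed.
End measurable_matchings.

Section edge_costs.
Context (R : realType) (h : R) (h0 : 0 < h) (m n : nat).

Definition edge_law (e : edge m n) : probability R R :=
  if is_ghost_edge e then exponential_law h0 else exponential_law (@ltr01 R).

Lemma edge_law_set1 e r : edge_law e [set r] = 0%E.
Proof. by rewrite /edge_law; case: ifP => _; rewrite [LHS]exponential_law_set1. Qed.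

Lemma edge_law_lt0 e : edge_law e [set r | r < 0] = 0%E.
Proof. by rewrite /edge_law; case: ifP => _; rewrite [LHS]exponential_law_lt0. Qed.

Context d (T : measurableType d) (P : probability T R) (V : T -> vec R (edge m n)).
Hypothesis PV : has_product_law edge_law P V.

(** Two different edge sets differ in some edge [e]. Given the other costs, equality of the sums
    forces a single value on the cost of [e], and the exponential laws have no atoms. As all edge
    sets are covered, one null set serves every class of matchings. *)
Lemma ae_cost_injective : {ae P, forall w, injective (cost (V w))}.
Proof.
have key (M N : {set edge m n}) e : e \in M -> e \notin N ->
    {ae P, forall w, cost (V w) M <> cost (V w) N}.
  move=> eM eN; apply: (@resample_negligible _ _ _ _ _ _ _ PV [set x | cost x M = cost x N] e).
    rewrite [X in measurable X](_ : _ = [set x | cost x M == cost x N]); last first.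
      by apply/seteqP; split=> x /= /eqP.
    rewrite -[X in measurable X]setTI.
    exact: (measurable_fun_eqr (measurable_cost M) (measurable_cost N)).
  move=> x; apply/eqP; rewrite -measure_le0 -(edge_law_set1 e (cost x N - cost x (M :\ e))).
  have -> : [set z | [set x | cost x M = cost x N] (upd x e z)] = [set cost x N - cost x (M :\ e)].
    apply/seteqP; split=> z /=; rewrite (costD1 _ eM) (cost_upd _ _ eN) cost_upd ?setD11 ?inE ?eqxx//;
      rewrite /upd eqxx.
      by move=> <-; rewrite addrK.
    by move=> ->; rewrite subrK.
  exact: lexx.
have h2 (M N : {set edge m n}) : M != N -> {ae P, forall w, cost (V w) M <> cost (V w) N}.
  move=> MN; have [sub|/subsetPn[e eM eN]] := boolP (M \subset N); last exact: key eM eN.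
  have /subsetPn[e eN eM] : ~~ (N \subset M).
    by apply: contra MN => sub'; rewrite finset.eqEsubset sub sub'.
  by apply: filterS (key _ _ _ eN eM) => w ne /esym.
have : {ae P, forall w, forall p : {set edge m n} * {set edge m n},
    p.1 != p.2 -> cost (V w) p.1 <> cost (V w) p.2}.
  apply: filter_forall => -[M N] /=; have [->|MN] := eqVneq M N; first exact: filterE.
  by apply: filterS (h2 _ _ MN) => w ne _.
apply: filterS => w inj M N MN; apply/eqP/negPn/negP => /(inj (M, N)); exact.
Qed.

Lemma ae_cost_ge0 : {ae P, forall w, forall e, 0 <= V w e}.
Proof.
have : {ae P, forall w, forall e, ~ (V w e < 0)}.
  apply: filter_forall => e.
  apply: (@coordinate_negligible _ _ _ _ _ _ _ PV [set r | r < 0] e); last exact: edge_law_lt0.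
  by rewrite -[X in measurable X]set_itvNyo//; exact: measurable_itv.
by apply: filterS => w nn e; rewrite leNgt; apply/negP.
Qed.
End edge_costs.

(** * Pairs of optimal matchings and the choice of the new edge *)

Section pair_weight.
Context (R : realType) (m n : nat) (b : 'I_n) (k : nat) (psi : R -> R).
Implicit Types (M N : {set edge m n}) (x : edge m n -> R).

Definition optimal_pair x M' M :=
  optimal (avoids b k) x M' && optimal (kmatching k.+1) x M.

(** The contribution of one pair to the expectation of [psi] at the minimum cost. With both
    matchings fixed, the competition between edges becomes a change of [M] alone. *)
Definition pair_weight M' M x : R := psi (cost x M) * (optimal_pair x M' M)%:R.

Lemma bounded_measurable_pair_weight M' M : bounded_measurable psi ->
  bounded_measurable (pair_weight M' M : vec R (edge m n) -> R).
Proof.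
move=> bpsi; have -> : pair_weight M' M = fun x : vec R (edge m n) => psi (cost x M) *
    ((optimal (avoids b k) x M')%:R * (optimal (kmatching k.+1) x M)%:R).
  by apply/funext => x; rewrite /pair_weight /optimal_pair -mulnb natrM.
apply: bounded_measurableM; first exact: bounded_measurable_cost.
by apply: bounded_measurableM; exact: bounded_measurable_optimal.
Qed.

(** If [e'] were cheaper than [e], swapping would improve [M] and the weight is 0; otherwise [e']
    can be lowered to the cost of [e]. The weight thus becomes a function of the cost of [e] times a
    comparison, the form needed for competing clocks. *)
Lemma pair_weight_lower M' M x e e' : e.2 = e'.2 -> lab e != lab e' ->
  lab e \notin lab @: M' -> lab e' \notin lab @: M' ->
  e \in M -> lab e' \notin lab @: (M :\ e) ->
  pair_weight M' M x = pair_weight M' M (upd x e' (x e)) * (x e <= x e')%R%:R.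
Proof.
move=> col lee' le le' eM le'M.
have e'M : e' \notin M.
  apply: contra le'M => e'M; apply: imset_f; rewrite !inE e'M andbT.
  by apply: contraNneq lee' => ->.
have e'M' : e' \notin M' by apply: contra le' => ?; exact: imset_f.
rewrite /pair_weight cost_upd//; case: (leP (x e) (x e')) => [xe|xe]; last first.
  rewrite mulr0; apply/eqP; rewrite mulf_eq0 pnatr_eq0 eqb0; apply/orP; right.
  apply: contraTN xe => /andP[_ oM]; rewrite -leNgt.
  by apply: (optimal_le_swap oM) => //.
rewrite mulr1; congr (_ * (nat_of_bool _)%:R); rewrite /optimal_pair; apply/andP/andP => -[p1 p2].
  split; first exact: (@optimal_lower_avoids _ _ _ _ _ M' e e' x).
  exact: (@optimal_lower_kmatching _ _ _ b k M' M e e' x).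
by split; [exact: optimal_raise p1|exact: optimal_raise p2].
Qed.

Lemma pair_weight_swap M' M y e e' : e.2 = e'.2 -> lab e != lab e' ->
  kmatching k.+1 M -> e \in M -> lab e' \notin lab @: (M :\ e) -> y e = y e' ->
  pair_weight M' M y = pair_weight M' (swap e' e M) y.
Proof.
move=> col lee' kM eM le'M yee'.
have e'M : e' \notin M.
  apply: contra le'M => e'M; apply: imset_f; rewrite !inE e'M andbT.
  by apply: contraNneq lee' => ->.
have cE : cost y (swap e' e M) = cost y M by rewrite cost_swap// yee' addrK.
rewrite /pair_weight cE /optimal_pair; congr (_ * (nat_of_bool (_ && _))%:R).
rewrite /optimal cE kM kmatching_swap//=.
Qed.
End pair_weight.

Section pair_weight_expectation.
Context (R : realType) (h : R) (h0 : 0 < h) (m n : nat).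
Context d (T : measurableType d) (P : probability T R) (V : T -> vec R (edge m n)).
Hypothesis PV : has_product_law (@edge_law R h h0 m n) P V.
Context (b : 'I_n) (k : nat) (psi : R -> R) (bpsi : bounded_measurable psi).
Implicit Types (M N : {set edge m n}) (x : edge m n -> R).
Local Notation p M' M := (\int[P]_w pair_weight b k psi M' M (V w)).

(** Up to the comparison, [M] and its swap have the same weight as a function of the smaller of two
    costs with rates h and 1. The factor is the ratio of these rates. *)
Lemma expectation_pair_swap M' M (j : 'I_n) (a : 'I_m) : kmatching k.+1 M ->
  inr j \notin lab @: M' -> inl a \notin lab @: M' ->
  (None, j) \in M -> inl a \notin lab @: (M :\ (None, j)) ->
  p M' M = h * p M' (swap (Some a, j) (None, j) M).
Proof.
move=> kM jM' aM' gM aM.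
pose e : edge m n := (None, j); pose e' : edge m n := (Some a, j).
set M2 := swap e' e M.
have e'e : e' != e by apply/eqP => /(congr1 fst).
have e'M2 : e' \in M2 by rewrite !inE eqxx.
have eM2 : lab e \notin lab @: (M2 :\ e').
  apply/imsetP => -[f]; rewrite !inE => /andP[/negPf -> /= /andP[fe fM]] lf.
  have /kmatchingP[[rM _] _] := kM.
  by rewrite (rM _ _ fM gM) ?eqxx// in fe.
pose f x u := pair_weight b k psi M' M (upd (upd x e u) e' u).
pose G1 x := \int[exponential_law (@ltr01 R)]_v pair_weight b k psi M' M (upd x e' v).
pose G2 x := \int[exponential_law h0]_z pair_weight b k psi M' M2 (upd x e z).
have bW M0 := bounded_measurable_pair_weight b k M' M0 bpsi.
have bG1 : bounded_measurable (G1 : vec R (edge m n) -> R).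
  exact: (bounded_measurable_resample (@edge_law R h h0 m n) e' (bW M)).
have bG2 : bounded_measurable (G2 : vec R (edge m n) -> R).
  exact: (bounded_measurable_resample (@edge_law R h h0 m n) e (bW M2)).
(* The two coordinates are resampled in opposite orders, the edge that lies in the matching being
   the outer variable each time. *)
have -> : p M' M = \int[P]_w \int[exponential_law h0]_z G1 (upd (V w) e z).
  by rewrite (resample e' PV (bW M)); exact: (resample e PV bG1).
have -> : p M' M2 = \int[P]_w \int[exponential_law (@ltr01 R)]_v G2 (upd (V w) e' v).
  by rewrite (resample e PV (bW M2)); exact: (resample e' PV bG2).
have bH : bounded_measurable (fun w => \int[exponential_law (@ltr01 R)]_v G2 (upd (V w) e' v)).
  exact: (bounded_measurable_law PV (bounded_measurable_resample (@edge_law R h h0 m n) e' bG2)).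
rewrite -RintegralZl//; last exact: Rintegral_bounded_integrable.
apply: eq_Rintegral => w _.
have bf : bounded_measurable (f (V w)).
  apply: (bounded_measurable_comp (bW M)).
  by do 2!apply: measurable_upd => //; exact: measurable_cst.
have := competing_exponentials h0 (@ltr01 R) bf; rewrite mul1r.
have ind (u v : R) : \1_[set v | u <= v] v = (u <= v)%R%:R :> R.
  by rewrite indicE; congr ((nat_of_bool _)%:R); apply/idP/idP => [/set_mem|/mem_set].
have -> : \int[exponential_law h0]_z \int[exponential_law (@ltr01 R)]_v
    (f (V w) z * \1_[set v | z <= v] v) =
    \int[exponential_law h0]_z G1 (upd (V w) e z).
  apply: eq_Rintegral => z _; apply: eq_Rintegral => v _.
  rewrite ind [RHS](@pair_weight_lower _ _ _ _ _ _ _ _ _ e e')//.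
  have -> : upd (upd (V w) e z) e' v e = z by rewrite /upd eq_sym (negPf e'e) eqxx.
  have -> : upd (upd (V w) e z) e' v e' = v by rewrite /upd eqxx.
  congr (pair_weight _ _ _ _ _ _ * _).
  by apply/funext => i; rewrite /upd; case: ifP.
have -> // : \int[exponential_law (@ltr01 R)]_v \int[exponential_law h0]_z
    (f (V w) v * \1_[set z | v <= z] z) =
    \int[exponential_law (@ltr01 R)]_v G2 (upd (V w) e' v).
apply: eq_Rintegral => v _; apply: eq_Rintegral => z _.
rewrite ind [RHS](@pair_weight_lower _ _ _ _ _ _ _ _ _ e' e)//.
have -> : upd (upd (V w) e' v) e z e' = v by rewrite /upd (negPf e'e) eqxx.
have -> : upd (upd (V w) e' v) e z e = z by rewrite /upd eqxx.
(* When the two edges have equal costs, [M] and [M2] have equal weights, so the same [f] appears on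
   both sides. *)
congr (_ * _); rewrite /f (@pair_weight_swap _ _ _ _ _ _ _ _ _ e e')//.
  congr (pair_weight _ _ _ _ _ _); apply/funext => i; rewrite /upd.
  by case: (i == e'); case: (i == e).
by rewrite /upd !eqxx eq_sym (negPf e'e).
Qed.
End pair_weight_expectation.

Section new_edge.
Context (m n k : nat).
Implicit Types (M N : {set edge m n}) (e f : edge m n).

(** Only vertex sets are compared: [M :\ e] need not be [M']. *)
Definition new_edge M' M e :=
  [&& kmatching k.+1 M, e \in M, lab e \notin lab @: M' & lab @: (M :\ e) == lab @: M'].

Lemma new_edge_unique M' M e f : new_edge M' M e -> new_edge M' M f -> e = f.
Proof.
move=> /and4P[_ _ _ /eqP labE] /and4P[_ fM fM' _]; apply/eqP; rewrite eq_sym.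
by apply: contraNT fM' => fe; rewrite -labE; apply: imset_f; rewrite !inE fe.
Qed.

Lemma new_edge_ghost_count M' M e : kmatching k M' -> new_edge M' M e ->
  ghost_count M = (ghost_count M' + is_ghost_edge e)%N.
Proof. by move=> kM' /and4P[kM eM _ /eqP labE]; exact: ghost_count_nested kM' kM eM labE. Qed.

Lemma new_edge_swap M' M e e' : new_edge M' M e -> e'.2 = e.2 -> lab e != lab e' ->
  lab e' \notin lab @: M' ->
  new_edge M' (swap e' e M) e' && (swap e e' (swap e' e M) == M).
Proof.
move=> /and4P[kM eM le /eqP labE] col lee' le'.
have e'Me : e' \notin M :\ e.
  by apply: contra le' => e'M; rewrite -labE; exact: imset_f.
have swapD1 : swap e' e M :\ e' = M :\ e by rewrite /swap setU1K.
rewrite /new_edge swapD1 labE eqxx andbT le' {2}/swap setU11 /= andbT.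
rewrite kmatching_swap ?labE//=.
by rewrite {1}/swap swapD1 finset.setD1K.
Qed.

(** The label [inr j] is carried only by an edge in column [j], and in [M] that column is taken by
    the ordinary edge [e]. Hence the ghost edge of the column is an admissible competitor of [e]. *)
Lemma new_edge_col M' M (j : 'I_n) e : new_edge M' M e -> e.2 = j -> ~~ is_ghost_edge e ->
  inr j \notin lab @: M'.
Proof.
move=> /and4P[kM eM le /eqP labE] ej ge; rewrite -labE; apply/imsetP => -[f /setD1P[fe fM] jf].
have /kmatchingP[[_ cM] _] := kM; case/eqP: fe; apply: cM => //.
by move: jf; rewrite /lab ej; case: f.1 => // -[->].
Qed.
End new_edge.

Lemma big_ghost_edges (S : zmodType) (m n : nat) (F : edge m n -> S) :
  \sum_(e | is_ghost_edge e) F e = \sum_(j < n) F (None, j).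
Proof.
rewrite (partition_big (fun e : edge m n => e.2) xpredT)//=; apply: eq_bigr => j _.
by rewrite (big_pred1 (None, j))//; case=> u j' /=; rewrite /is_ghost_edge /=.
Qed.

Lemma sum_free_edges (S : zmodType) (m n : nat) (G : 'I_n -> S) (Q : pred 'I_m) :
  \sum_(e : edge m n | if e.1 is Some a then Q a else false) G e.2 =
  (\sum_(j < n) G j) *+ #|[set a | Q a]%SET|.
Proof.
rewrite (partition_big (fun e : edge m n => e.2) xpredT)//= -sumrMnl; apply: eq_bigr => j _.
rewrite (eq_bigr (fun=> G j)); last by move=> e /andP[_ /eqP->].
rewrite big_const iter_addr_0 -(@card_imset _ _ (fun a : 'I_m => (Some a, j))); last first.
  by move=> a a' [].
congr (_ *+ _); apply: eq_card; case=> u j'; rewrite unfold_in /=.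
apply/andP/imsetP => [|[a]].
  by case: u => [a [Qa /eqP->]|[]//]; exists a; rewrite ?inE.
by rewrite inE => Qa [-> ->].
Qed.

Section pair_sums.
Context (R : realType) (h : R) (h0 : 0 < h) (m n : nat).
Context d (T : measurableType d) (P : probability T R) (V : T -> vec R (edge m n)).
Hypothesis PV : has_product_law (@edge_law R h h0 m n) P V.
Context (b : 'I_n) (k : nat) (psi : R -> R) (bpsi : bounded_measurable psi).
Implicit Types (M N : {set edge m n}) (x : edge m n -> R).
Local Notation p M' M := (\int[P]_w pair_weight b k psi M' M (V w)).

(** There is at most one new edge, and a pair without one is almost surely not optimal because
    optimal matchings are nested. This lets sums over [M] be regrouped by the new edge. *)
Lemma expectation_pair_new_edge M' M :
  p M' M = \sum_(e | new_edge k M' M e) p M' M.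
Proof.
have [[e eP]|noe] := pselect (exists e, new_edge k M' M e).
  rewrite (big_pred1 e)// => f; apply/idP/eqP => [fP|->//].
  exact: new_edge_unique fP eP.
rewrite big_pred0; last by move=> e; apply/negP => eP; apply: noe; exists e.
transitivity (\int[P]_w (0 : R)); last by rewrite Rintegral_cst// mul0r.
apply: ae_eq_Rintegral.
- exact: (bounded_measurable_law PV (bounded_measurable_pair_weight b k M' M bpsi)).
- exact: bounded_measurable_cst.
apply: filterS (ae_cost_injective PV) => w inj.
rewrite /pair_weight; case E : optimal_pair; last by rewrite mulr0.
case/andP: E => p1 p2; exfalso; apply: noe.
have [e eM [le labE]] := optimal_nested inj p1 p2.
exists e; apply/and4P; split=> //; last exact/eqP.
by have /optimalP[] := p2.
Qed.

(** Swapping [e'] and [e] is a bijection between the matchings with new edge [e'] and those with new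
    edge [e], and each expectation changes by the factor h. *)
Lemma sum_expectation_new_edge M' e e' : e'.2 = e.2 -> ~~ is_ghost_edge e' -> is_ghost_edge e ->
  lab e' \notin lab @: M' ->
  h * \sum_(M | new_edge k M' M e') p M' M = \sum_(M | new_edge k M' M e) p M' M.
Proof.
move=> col ge' ge le'.
have lee' : lab e != lab e'.
  by move: ge ge'; rewrite /is_ghost_edge /lab; case: e.1 => //; case: e'.1.
have el : lab e = inr e.2 by move: ge; rewrite /is_ghost_edge /lab => /eqP->.
rewrite (reindex_onto (swap e' e) (swap e e')); last first.
  move=> M Me'; have le : lab e \notin lab @: M'.
    by rewrite el; exact: new_edge_col Me' col ge'.
  by have /andP[_ /eqP] := new_edge_swap Me' (esym col) (negbT (etrans (eq_sym _ _) (negbTE lee'))) le.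
rewrite mulr_sumr; apply: eq_big => M.
  apply/andP/idP => [[Me' /eqP <-]|Me].
    have le : lab e \notin lab @: M'.
      by rewrite el; exact: new_edge_col Me' col ge'.
    by have /andP[] := new_edge_swap Me' (esym col) (negbT (etrans (eq_sym _ _) (negbTE lee'))) le.
  by have /andP[] := new_edge_swap Me col lee' le'.
move=> /andP[Me' /eqP ME]; have le : lab e \notin lab @: M'.
  by rewrite el; exact: new_edge_col Me' col ge'.
have /andP[+ _] := new_edge_swap Me' (esym col) (negbT (etrans (eq_sym _ _) (negbTE lee'))) le.
rewrite ME => /and4P[kM eM _ /eqP labE].
case: e' e col ge ge' lee' el le le' eM labE {Me' ME} => [[a|]//] j [[|]//] j' /= -> _ _ _ _ le le' eM labE.
have aM : inl a \notin lab @: (M :\ (None, j')) by rewrite labE.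
exact: esym (expectation_pair_swap PV b bpsi kM le le' eM aM).
Qed.

(** In each column the ghost edge competes with one ordinary edge per free vertex a_i, and each of
    these is favoured over it by the factor 1/h. The coefficient on the right counts the free
    vertices. *)
Lemma expectation_pair_balance M' : avoids b k M' -> (k <= m)%N ->
  h * \sum_(M | ghost_count M == ghost_count M') p M' M =
  (m - k + ghost_count M')%:R * \sum_(M | ghost_count M == (ghost_count M').+1) p M' M.
Proof.
move=> /andP[kM' _] km; rewrite -(card_free_rows kM' km).
have split_sum (g : bool) :
    \sum_(M | ghost_count M == (ghost_count M' + g)%N) p M' M =
    \sum_(e | is_ghost_edge e == g) \sum_(M | new_edge k M' M e) p M' M.
  under eq_bigr do rewrite expectation_pair_new_edge.
  rewrite (exchange_big_dep (fun e => is_ghost_edge e == g))/=.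
    apply: eq_bigr => e /eqP eg; apply: eq_bigl => M.
    rewrite andb_idl// => Me; rewrite (new_edge_ghost_count kM' Me) eg; exact: eqxx.
  move=> M e /eqP gM Me; have := new_edge_ghost_count kM' Me; rewrite gM {gM} => /addnI.
  by case: g; case: (is_ghost_edge e).
have := split_sum false; rewrite addn0 => ->.
have := split_sum true; rewrite addn1 => ->.
under [in RHS]eq_bigl do rewrite eqb_id.
rewrite big_ghost_edges mulr_natl -sum_free_edges.
(* Ordinary edges from vertices already used by [M'] are never new and contribute nothing. *)
rewrite (bigID (fun e : edge m n => if e.1 is Some a then inl a \notin lab @: M' else false))/=.
rewrite [X in _ + X]big1 ?addr0; last first.
  case=> -[a|] j /andP[ge]; last by rewrite /is_ghost_edge /= in ge.
  move=> /negPn aM'; rewrite big_pred0// => M.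
  by apply/negP => /and4P[_ _]; rewrite /lab /= aM'.
rewrite mulr_sumr; apply: eq_big; first by case=> -[a|] j.
case=> -[a|] j /andP[ge]//= aM'.
exact: sum_expectation_new_edge.
Qed.
End pair_sums.

Lemma balance_split (F : fieldType) (r h u v : F) : r + h != 0 -> h * u = r * v ->
  u = r / (r + h) * (u + v) /\ v = h / (r + h) * (u + v).
Proof.
move=> rh hr; split; apply: (mulfI rh).
  by rewrite mulrA mulrCA divff// mulr1 mulrDl mulrDr hr.
by rewrite mulrA mulrCA divff// mulr1 mulrDl mulrDr hr addrC.
Qed.

(** * The exchange identity for expectations *)

Section recursion_step.
Context (R : realType) (h : R) (h0 : 0 < h) (m n : nat).
Context d (T : measurableType d) (P : probability T R) (V : T -> vec R (edge m n)).
Hypothesis PV : has_product_law (@edge_law R h h0 m n) P V.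
Context (b : 'I_n) (k : nat).
Hypothesis kmn : (k.+1 <= minn m n)%N.
Implicit Types (M N : {set edge m n}) (x : edge m n -> R) (Q : pred {set edge m n}).
Local Notation p psi M' M := (\int[P]_w pair_weight b k psi M' M (V w)).
Local Notation ghosts c := (fun M : {set edge m n} => ghost_count M == c).
Local Notation Kev := (optimal_event (R := R) (kmatching k.+1)).
Local Notation Aev := (optimal_event (R := R) (avoids b k)).
Local Notation C x := (optimum (kmatching k.+1) x).
Local Notation Y x := (optimum (avoids b k) x).

Lemma ae_ghost_counts : {ae P, forall w, exists g (t : bool), forall c,
  \1_(Aev (ghosts c)) (V w) = (g == c)%:R :> R /\
  \1_(Kev (ghosts c)) (V w) = (g + t == c)%:R :> R}.
Proof.
apply: filterS (ae_cost_injective PV) => w inj.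
have [M' p1] := optimal_avoids_exists b kmn (V w).
have [M p2] := optimal_kmatching_exists b kmn (V w).
have [t gM] := optimal_ghost_count inj p2 p1.
exists (ghost_count M'), t => c; split.
  exact: (indic_optimal_event _ inj p1).
by rewrite (indic_optimal_event _ inj p2) gM.
Qed.

Lemma bounded_measurable_product (psi : R -> R) Q' Q : bounded_measurable psi ->
  bounded_measurable (fun w => psi (C (V w)) * (\1_(Aev Q') (V w) * \1_(Kev Q) (V w))).
Proof.
move=> bpsi.
apply: (bounded_measurable_law PV (F := fun x : vec R (edge m n) => psi (C x) * (\1_(Aev Q') x * \1_(Kev Q) x))).
apply: bounded_measurableM; first exact: bounded_measurable_optimum.
by apply: bounded_measurableM; exact: bounded_measurable_optimal_event.
Qed.

Lemma bounded_measurable_weighted_event (psi : R -> R) F0 F Q : bounded_measurable psi ->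
  bounded_measurable (fun w => psi (optimum F0 (V w)) * \1_(optimal_event F Q) (V w)).
Proof.
move=> bpsi.
apply: (bounded_measurable_law PV (F := fun x : vec R (edge m n) => psi (optimum F0 x) * \1_(optimal_event F Q) x)).
apply: bounded_measurableM; first exact: bounded_measurable_optimum.
exact: bounded_measurable_optimal_event.
Qed.

Section weights.
Context (psi : R -> R) (bpsi : bounded_measurable psi).

(** Almost surely exactly one pair of matchings is optimal, so the integrand is a sum of weights
    with a single possibly nonzero term. *)
Lemma expectation_pair_sum Q' Q :
  \int[P]_w (psi (C (V w)) * (\1_(Aev Q') (V w) * \1_(Kev Q) (V w))) =
  \sum_(M' | Q' M') \sum_(M | Q M) p psi M' M.
Proof.
have bW M' M : bounded_measurable (fun w => pair_weight b k psi M' M (V w)).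
  exact: (bounded_measurable_law PV (bounded_measurable_pair_weight b k M' M bpsi)).
under eq_bigr do rewrite -Rintegral_fsum//.
rewrite -Rintegral_fsum; last by move=> M'; exact: bounded_measurable_sum.
apply: ae_eq_Rintegral.
- exact: bounded_measurable_product.
- by apply: bounded_measurable_sum => M' _; exact: bounded_measurable_sum.
apply: filterS (ae_cost_injective PV) => w inj.
have [M0' p1] := optimal_avoids_exists b kmn (V w).
have [M0 p2] := optimal_kmatching_exists b kmn (V w).
rewrite (indic_optimal_event _ inj p1) (indic_optimal_event _ inj p2) (optimum_optimal p2).
have wE M' M : pair_weight b k psi M' M (V w) = psi (cost (V w) M0) * ((M' == M0')%:R * (M == M0)%:R).
  rewrite /pair_weight /optimal_pair -natrM mulnb.
  have -> : optimal (avoids b k) (V w) M' = (M' == M0').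
    by apply/idP/eqP => [h1|->//]; exact: (optimal_unique inj h1 p1).
  have -> : optimal (kmatching k.+1) (V w) M = (M == M0).
    by apply/idP/eqP => [h2|->//]; exact: (optimal_unique inj h2 p2).
  by case: eqP => [_|]; case: eqP => [->|]; rewrite //= !mulr0.
under eq_bigr do under eq_bigr do rewrite wE.
under eq_bigr do rewrite -mulr_sumr -mulr_sumr.
rewrite -mulr_sumr -mulr_suml; congr (_ * (_ * _)).
  have [Q0|Q0] := boolP (Q' M0').
    by rewrite (bigD1 M0')//= eqxx big1 ?addr0// => M /andP[_ /negPf->].
  by rewrite big1// => M QM; case: eqP QM Q0 => // -> ->.
have [Q0|Q0] := boolP (Q M0).
  by rewrite (bigD1 M0)//= eqxx big1 ?addr0// => M /andP[_ /negPf->].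
by rewrite big1// => M QM; case: eqP QM Q0 => // -> ->.
Qed.

Lemma expectation_split_optimum c :
  \int[P]_w (psi (C (V w)) * \1_(Kev (ghosts c)) (V w)) =
  \int[P]_w (psi (C (V w)) * (\1_(Aev (ghosts c)) (V w) * \1_(Kev (ghosts c)) (V w))) +
  (if c is c'.+1 then
  \int[P]_w (psi (C (V w)) * (\1_(Aev (ghosts c')) (V w) * \1_(Kev (ghosts c)) (V w))) else 0).
Proof.
have bW := bounded_measurable_product _ _ bpsi.
case: c => [|c].
  rewrite addr0; apply: ae_eq_Rintegral; [exact: bounded_measurable_weighted_event|exact: bW|].
  apply: filterS ae_ghost_counts => w [g [t gt]].
  rewrite (gt _).1 (gt _).2; congr (_ * _).
  by case: g {gt} => [|g]; rewrite ?mul1r ?mul0r.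
rewrite -RintegralD//; [|exact: Rintegral_bounded_integrable..].
apply: ae_eq_Rintegral; [exact: bounded_measurable_weighted_event|exact: bounded_measurableD|].
apply: filterS ae_ghost_counts => w [g [t gt]].
rewrite !(gt _).1 !(gt _).2 -mulrDr -mulrDl -natrD; congr (_ * _); rewrite -natrM.
by congr (_%:R); case: t {gt} => /=; lia.
Qed.

Lemma expectation_split_avoids c :
  \int[P]_w (psi (C (V w)) * \1_(Aev (ghosts c)) (V w)) =
  \int[P]_w (psi (C (V w)) * (\1_(Aev (ghosts c)) (V w) * \1_(Kev (ghosts c)) (V w))) +
  \int[P]_w (psi (C (V w)) * (\1_(Aev (ghosts c)) (V w) * \1_(Kev (ghosts c.+1)) (V w))).
Proof.
have bW := bounded_measurable_product _ _ bpsi.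
rewrite -RintegralD//; [|exact: Rintegral_bounded_integrable..].
apply: ae_eq_Rintegral; [exact: bounded_measurable_weighted_event|exact: bounded_measurableD|].
apply: filterS ae_ghost_counts => w [g [t gt]].
rewrite !(gt _).1 !(gt _).2 -mulrDr -mulrDr -natrD; congr (_ * _); rewrite -natrM.
by congr (_%:R); case: t {gt} => /=; lia.
Qed.

Lemma expectation_balance c :
  h * \int[P]_w (psi (C (V w)) * (\1_(Aev (ghosts c)) (V w) * \1_(Kev (ghosts c)) (V w))) =
  (m - k + c)%:R * \int[P]_w (psi (C (V w)) * (\1_(Aev (ghosts c)) (V w) * \1_(Kev (ghosts c.+1)) (V w))).
Proof.
rewrite !expectation_pair_sum !mulr_sumr; apply: eq_bigr => M' /eqP <-.
have [kM'|kM'] := boolP (avoids b k M').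
  apply: (expectation_pair_balance PV bpsi kM').
  by move: kmn; rewrite leq_min => /andP[/ltnW].
rewrite !big1 ?mulr0// => M _.
  transitivity (\int[P]_w (0 : R)); last by rewrite Rintegral_cst// mul0r.
  apply: eq_Rintegral => w _; rewrite /pair_weight /optimal_pair /optimal (negPf kM') /=.
  by rewrite mulr0.
transitivity (\int[P]_w (0 : R)); last by rewrite Rintegral_cst// mul0r.
apply: eq_Rintegral => w _; rewrite /pair_weight /optimal_pair /optimal (negPf kM') /=.
by rewrite mulr0.
Qed.

(** If [M'] has [c'] ghost edges, then [M] has [c'] or [c'.+1]. The sum of the two contributions and
    their ratio are known, which is a linear system; [M] with [c] ghost edges then arises from [c]
    or from [c - 1]. *)
Lemma expectation_exchange c :
  \int[P]_w (psi (C (V w)) * \1_(Kev (ghosts c)) (V w)) =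
  (m - k + c)%:R / ((m - k + c)%:R + h) *
    \int[P]_w (psi (C (V w)) * \1_(Aev (ghosts c)) (V w)) +
  (if c is c'.+1 then h / ((m - k + c')%:R + h) *
    \int[P]_w (psi (C (V w)) * \1_(Aev (ghosts c')) (V w)) else 0).
Proof.
have key c' : let W e := \int[P]_w (psi (C (V w)) * (\1_(Aev (ghosts c')) (V w) * \1_(Kev (ghosts e)) (V w))) in
    let L := \int[P]_w (psi (C (V w)) * \1_(Aev (ghosts c')) (V w)) in
    W c' = (m - k + c')%:R / ((m - k + c')%:R + h) * L /\ W c'.+1 = h / ((m - k + c')%:R + h) * L.
  move=> W L; have := expectation_balance c'; have := expectation_split_avoids c'.
  rewrite -/(W c') -/(W c'.+1) -/L => -> bal.
  by apply: balance_split => //; rewrite gt_eqF// ltr_wpDl.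
rewrite expectation_split_optimum (key c).1; congr (_ + _).
by case: c => // c; rewrite (key c).2.
Qed.
End weights.
End recursion_step.

(** * Integration by parts in the cost of a ghost edge *)

Section ghost_by_parts.
Context (R : realType) (h : R) (h0 : 0 < h) (m n : nat).
Context d (T : measurableType d) (P : probability T R) (V : T -> vec R (edge m n)).
Hypothesis PV : has_product_law (@edge_law R h h0 m n) P V.
Context (b : 'I_n) (k : nat).
Hypothesis kmn : (k.+1 <= minn m n)%N.
Local Notation ghosts c := (fun M : {set edge m n} => ghost_count M == c).
Local Notation Kev := (optimal_event (R := R) (kmatching k.+1)).
Local Notation Aev := (optimal_event (R := R) (avoids b k)).
Local Notation C x := (optimum (kmatching k.+1) x).
Local Notation Y x := (optimum (avoids b k) x).
Local Notation Z x := (optimum (no_ghost b k) x).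
Local Notation g := ((None, b) : edge m n).

Context (phi phi' : R -> R).
Hypothesis dphi : forall x : R, is_derive x 1 phi (phi' x).
Hypothesis cphi' : continuous phi'.
Hypothesis bphi : bounded_measurable (fun x : R => phi (Num.max x 0)).
Hypothesis bphi' : bounded_measurable (fun x : R => phi' (Num.max x 0)).

(** Here [x g] is the cost of [(g, b)], while [Z] is the optimum over [no_ghost]. The values [Y],
    [Z] and the event for [M'] do not depend on [x g], so the one-dimensional formula applies to
    [Num.min Z (Y + x g)]. Its indicator of [Y + x g <= Z] says that [(g, b)] lies in [M]; then [M]
    is [M'] with this edge added, whence [c.+1]. *)
Lemma expectation_ghost_by_parts c :
  \int[P]_w (phi (Num.max (C (V w)) 0) * \1_(Aev (ghosts c)) (V w)) =
  \int[P]_w (phi (Num.max (Y (V w)) 0) * \1_(Aev (ghosts c)) (V w)) +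
  h^-1 * \int[P]_w (phi' (Num.max (C (V w)) 0) *
    \1_(Kev (fun M => (g \in M) && (ghost_count M == c.+1))) (V w)).
Proof.
pose F1 (x : vec R (edge m n)) := phi (Num.max (C x) 0) * \1_(Aev (ghosts c)) x.
pose I3 (x : vec R (edge m n)) : R :=
  phi' (Num.max (Y x + x g) 0) * \1_[set x : vec R (edge m n) | Y x + x g <= Z x] x * \1_(Aev (ghosts c)) x.
pose F2 (x : vec R (edge m n)) :=
  phi (Num.max (Y x) 0) * \1_(Aev (ghosts c)) x + h^-1 * I3 x.
have bev Q : bounded_measurable (fun x : vec R (edge m n) => \1_(Aev Q) x : R).
  exact: bounded_measurable_optimal_event.
have mYg : measurable_fun setT (fun x : vec R (edge m n) => Y x + x g).
  apply: measurable_funD; first exact: measurable_optimum.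
  exact: measurable_coord.
have bF1 : bounded_measurable F1.
  by apply: bounded_measurableM => //; exact: (bounded_measurable_optimum _ bphi).
have bI3 : bounded_measurable I3.
  apply: bounded_measurableM => //; apply: bounded_measurableM.
    exact: (bounded_measurable_comp bphi' mYg).
  apply: bounded_measurable_indic; rewrite -[X in measurable X]setTI.
  exact: (measurable_fun_ler mYg (measurable_optimum (no_ghost b k))).
have bF2 : bounded_measurable F2.
  apply: bounded_measurableD.
    by apply: bounded_measurableM => //; exact: (bounded_measurable_optimum _ bphi).
  by apply: bounded_measurableM => //; exact: bounded_measurable_cst.
have -> : \int[P]_w (phi (Num.max (C (V w)) 0) * \1_(Aev (ghosts c)) (V w)) =
    \int[P]_w F2 (V w).
  apply: (resample_ae (e := g) PV bF1 bF2).
  apply: filterS (ae_cost_ge0 PV) => w w0.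
  have gA N : avoids b k N -> g \notin N by exact: ghost_notin_avoids.
  have gX N : no_ghost b k N -> g \notin N by move=> /andP[].
  have YE z : Y (upd (V w) g z) = Y (V w) by exact: (optimum_upd _ _ gA).
  have XE z : Z (upd (V w) g z) = Z (V w) by exact: (optimum_upd _ _ gX).
  have AE z : \1_(Aev (ghosts c)) (upd (V w) g z) = \1_(Aev (ghosts c)) (V w) :> R.
    rewrite !indicE; congr ((nat_of_bool _)%:R); apply/idP/idP => /set_mem[M];
      rewrite ?optimal_upd// => oM; apply/mem_set; exists M; rewrite ?optimal_upd//.
  have gE z : upd (V w) g z g = z by rewrite /upd eqxx.
  have Y0 : 0 <= Y (V w) by exact: optimum_avoids_ge0.
  have YX : Y (V w) <= Z (V w) by exact: optimum_avoids_le.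
  set a : R := \1_(Aev (ghosts c)) (V w).
  have mp := Rintegral_exponential_law_min h0 Y0 YX dphi cphi' bphi bphi'.
  have bmin : bounded_measurable (fun z : R => phi (Num.max (Num.min (Z (V w)) (Y (V w) + z)) 0)).
    apply: (bounded_measurable_comp bphi); apply: measurable_minr => //.
    exact: measurable_funD.
  have bz : bounded_measurable (fun z : R =>
      phi' (Num.max (Y (V w) + z) 0) * \1_[set z | Y (V w) + z <= Z (V w)] z).
    have mz : measurable_fun setT (fun z : R => Y (V w) + z) by exact: measurable_funD.
    apply: bounded_measurableM; first exact: (bounded_measurable_comp bphi' mz).
    apply: bounded_measurable_indic; rewrite -[X in measurable X]setTI.
    exact: (measurable_fun_ler mz (measurable_cst _)).
  transitivity (\int[exponential_law h0]_z
      (phi (Num.max (Num.min (Z (V w)) (Y (V w) + z)) 0) * a)).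
    apply: eq_Rintegral => z _; rewrite /F1 AE; congr (phi (Num.max _ _) * _).
    by rewrite (optimum_ghost b kmn) YE XE gE.
  rewrite RintegralZr//; last exact: Rintegral_bounded_integrable.
  rewrite mp mulrDl -mulrA.
  transitivity (\int[exponential_law h0]_z (phi (Y (V w)) * a + h^-1 *
      (phi' (Num.max (Y (V w) + z) 0) * \1_[set z | Y (V w) + z <= Z (V w)] z * a))).
    rewrite RintegralD//; last 2 first.
    - by apply: Rintegral_bounded_integrable; exact: bounded_measurable_cst.
    - apply: Rintegral_bounded_integrable; apply: bounded_measurableM; first exact: bounded_measurable_cst.
      by apply: bounded_measurableM => //; exact: bounded_measurable_cst.
    rewrite Rintegral_cst//; have /= -> := probability_setT (exponential_law h0).
    rewrite mulr1; congr (_ + _); rewrite RintegralZl//; last first.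
      by apply/Rintegral_bounded_integrable/bounded_measurableM => //; exact: bounded_measurable_cst.
    by rewrite RintegralZr//; exact: Rintegral_bounded_integrable.
  apply: eq_Rintegral => z _; rewrite /F2 /I3 AE YE gE -/a (max_l Y0).
  congr (_ + _ * (_ * _ * _)).
  rewrite !indicE; congr ((nat_of_bool _)%:R).
  by apply/idP/idP => /set_mem /= h1; apply/mem_set => /=; rewrite YE XE gE in h1 *.
rewrite /F2.
have b1 : bounded_measurable (fun w => phi (Num.max (Y (V w)) 0) * \1_(Aev (ghosts c)) (V w)).
  exact: (bounded_measurable_weighted_event PV (avoids b k) (avoids b k) (ghosts c) bphi).
have b3 : bounded_measurable (fun w => I3 (V w)) by exact: (bounded_measurable_law PV bI3).
rewrite RintegralD//; last 2 first.
- exact: Rintegral_bounded_integrable.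
- by apply/Rintegral_bounded_integrable/bounded_measurableM => //; exact: bounded_measurable_cst.
rewrite RintegralZl//; last exact: Rintegral_bounded_integrable.
congr (_ + _ * _); apply: ae_eq_Rintegral => //.
  exact: (bounded_measurable_weighted_event PV (kmatching k.+1) (kmatching k.+1) _ bphi').
apply: filterS (ae_cost_injective PV) => w inj.
have [M' p1] := optimal_avoids_exists b kmn (V w).
have [M p2] := optimal_kmatching_exists b kmn (V w).
rewrite /I3 (indic_optimal_event _ inj p1) (indic_optimal_event _ inj p2).
have gM := optimal_ghost_in kmn inj p2 p1.
have -> : \1_[set x : vec R (edge m n) | Y x + x g <= Z x] (V w) = (g \in M)%:R :> R.
  by rewrite gM indicE; congr ((nat_of_bool _)%:R); apply/idP/idP => [/set_mem|/mem_set].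
have [gM1|gM1] := boolP (g \in M); last by rewrite mulr0 mul0r mulr0.
rewrite mulr1 (optimal_ghostD1 inj p2 p1 gM1) eqSS; congr (phi' (Num.max _ _) * _).
by rewrite (optimum_ghost b kmn) min_r// -gM.
Qed.
End ghost_by_parts.

(** * Moments of the minimum cost *)

Section ghost_moment.
Context (R : realType) (m n : nat) d (T : measurableType d) (P : probability T R)
  (V : T -> vec R (edge m n)).

(* The cost is almost surely nonnegative; the maximum makes the test functions,
   which are bounded on the nonnegative half-line only, bounded. *)
Definition ghost_moment (k c : nat) (psi : R -> R) : R :=
  \int[P]_w (psi (Num.max (optimum (kmatching k) (V w)) 0) *
    \1_(optimal_event (kmatching k) (fun M => ghost_count M == c)) (V w)).

Context (h : R) (h0 : 0 < h).
Hypothesis PV : has_product_law (@edge_law R h h0 m n) P V.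
Context (psi psi1 psi2 : R -> R).
Hypothesis b1 : bounded_measurable (fun x : R => psi1 (Num.max x 0)).
Hypothesis b2 : bounded_measurable (fun x : R => psi2 (Num.max x 0)).

(** Needed because differentiation mixes the real and imaginary parts of e^(tx). *)
Lemma ghost_moment_linear (a1 a2 : R) k c :
  (forall x, psi x = a1 * psi1 x + a2 * psi2 x) ->
  ghost_moment k c psi = a1 * ghost_moment k c psi1 + a2 * ghost_moment k c psi2.
Proof.
move=> psiE; rewrite /ghost_moment.
under eq_Rintegral do rewrite psiE mulrDl -!mulrA.
have bw (f : R -> R) : bounded_measurable (fun x : R => f (Num.max x 0)) ->
    bounded_measurable (fun w => f (Num.max (optimum (kmatching k) (V w)) 0) *
    \1_(optimal_event (kmatching k) (fun M => ghost_count M == c)) (V w)).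
  by move=> bf; exact: (bounded_measurable_weighted_event PV (kmatching k) (kmatching k) _ bf).
have bz a (f : T -> R) : bounded_measurable (fun w : T => f w : R) ->
    bounded_measurable (fun w => a * f w).
  by move=> bf; apply: bounded_measurableM => //; exact: bounded_measurable_cst.
rewrite RintegralD//; [|exact/Rintegral_bounded_integrable/bz/bw..].
by rewrite !RintegralZl//; exact/Rintegral_bounded_integrable/bw.
Qed.

Lemma ghost_moment_gt k c : (k < c)%N -> ghost_moment k c psi = 0.
Proof.
move=> kc; transitivity (\int[P]_w (0 : R)); last by rewrite Rintegral_cst// mul0r.
apply: eq_Rintegral => w _; rewrite indicE memNset ?mulr0//.
move=> [M /andP[/optimalP[/kmatchingP[_ Mk] _] /eqP gM]].
by move: kc; rewrite -gM -Mk ltnNge subset_leq_card//; apply/fintype.subsetP => e; rewrite inE => /andP[].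
Qed.

Lemma ghost_moment0 c : ghost_moment 0 c psi = psi 0 * (c == 0%N)%:R.
Proof.
rewrite /ghost_moment; transitivity (\int[P]_w (psi 0 * (c == 0%N)%:R)); last first.
  by rewrite Rintegral_cst//; have /= -> := probability_setT P; rewrite mulr1.
apply: eq_Rintegral => w _.
have k0 M : kmatching 0 M = (M == finset.set0) :> bool.
  apply/kmatchingP/eqP => [[_ /eqP]|->]; first by rewrite cards_eq0 => /eqP.
  by split; [split=> e f; rewrite inE|rewrite cards0].
have o0 : optimal (kmatching 0) (V w) finset.set0.
  by apply/optimalP; split=> [|N]; rewrite k0// => /eqP->.
rewrite (optimum_optimal o0) /cost big_set0 maxxx indicE; congr (_ * (nat_of_bool _)%:R).
have g0 : ghost_count (finset.set0 : {set edge m n}) = 0%N.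
  by apply/eqP; rewrite cards_eq0; apply/eqP/setP => e; rewrite !inE.
apply/idP/eqP => [/set_mem[M /andP[/optimalP[+ _] /eqP <-]]|->].
  by rewrite k0 => /eqP->.
by apply/mem_set; exists finset.set0; rewrite o0 g0.
Qed.
End ghost_moment.

Section ghost_moment_recursion.
Context (R : realType) (h : R) (h0 : 0 < h) (m n : nat).
Context d (T : measurableType d) (P : probability T R) (V : T -> vec R (edge m n.+1)).
Hypothesis PV : has_product_law (@edge_law R h h0 m n.+1) P V.
Context d' (T' : measurableType d') (P' : probability T' R) (V' : T' -> vec R (edge m n)).
Hypothesis PV' : has_product_law (@edge_law R h h0 m n) P' V'.

Lemma product_law_widen (b : 'I_n.+1) :
  has_product_law (@edge_law R h h0 m n) P (fun w => V w \o widen_edge b : vec R (edge m n)).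
Proof.
have [mV VE] := PV; split.
  apply: measurable_vec => e; exact: (measurableT_comp (measurable_coord _) mV).
move=> S mS.
(* Column [b] is left unconstrained, so its factors in the product are 1. *)
pose S' (e : edge m n.+1) : set R :=
  if unlift b e.2 is Some j then S (e.1, j) else setT.
have mS' e : measurable (S' e) by rewrite /S'; case: unlift.
have -> : (fun w => V w \o widen_edge b : vec R (edge m n)) @^-1` cylinder S = V @^-1` cylinder S'.
  apply/seteqP; split=> w /= h1.
    case=> u j; rewrite /S' /=; case: unliftP => [j' ->|//].
    exact: (h1 (u, j')).
  case=> u j; have := h1 (widen_edge b (u, j)); rewrite /S' /widen_edge /= liftK.
  exact.
rewrite VE// (bigID (fun e : edge m n.+1 => e.2 == b))/= big1 ?mul1e; last first.
  by case=> u j /= /eqP->; rewrite /S' /= unlift_none; exact: probability_setT.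
rewrite (eq_bigl (fun e => e \in widen_edge b @: finset.setT)); last first.
  case=> u j; apply/idP/imsetP => [jb|[e _ /(congr1 snd)/= ->]]; last first.
    by rewrite eq_sym neq_lift.
  have [j' jj' _] := unlift_some (negbT (etrans (eq_sym _ _) (negbTE jb))).
  by exists (u, j'); rewrite ?inE // /widen_edge /= -jj'.
rewrite big_imset/=; last by move=> e f _ _; exact: widen_edge_inj.
by apply: eq_big => [e|e _]; [rewrite inE|rewrite /S' /= liftK; case: e].
Qed.

(** Outside column [b] the costs have the product law of the smaller graph. The value is therefore
    independent of [b] and of the probability space. *)
Lemma avoids_moment (b : 'I_n.+1) k c (psi : R -> R) :
  bounded_measurable (fun x : R => psi (Num.max x 0)) ->
  \int[P]_w (psi (Num.max (optimum (avoids b k) (V w)) 0) *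
    \1_(optimal_event (avoids b k) (fun M => ghost_count M == c)) (V w)) =
  ghost_moment P' V' k c psi.
Proof.
move=> bpsi.
pose F (x : vec R (edge m n)) := psi (Num.max (optimum (kmatching k) x) 0) *
    \1_(optimal_event (kmatching k) (fun M => ghost_count M == c)) x.
have bF : bounded_measurable F.
  apply: bounded_measurableM; first exact: (bounded_measurable_optimum _ bpsi).
  exact: bounded_measurable_optimal_event.
rewrite /ghost_moment -[RHS](Rintegral_product_law (product_law_widen b) PV' bF).
apply: eq_Rintegral => w _; rewrite /F -optimum_widen; congr (_ * _).
rewrite !indicE; congr ((nat_of_bool _)%:R); apply/idP/idP => /set_mem[M /andP[p1 gM]].
  have /optimalP[kM _] := p1; have [M' ME] := avoids_widen_ex kM.
  by apply/mem_set; exists M'; rewrite -optimal_widen -ME p1 -(ghost_count_widen b) -ME.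
by apply/mem_set; exists (widen_edge b @: M); rewrite optimal_widen p1 ghost_count_widen.
Qed.

(** The mixed quantity shared by the two identities: the cost is that of [M], the number of ghost
    edges that of [M']. It is eliminated between them. *)
Definition avoids_moment_sum (k c : nat) (psi : R -> R) : R :=
  \sum_(b < n.+1) \int[P]_w (psi (Num.max (optimum (kmatching k.+1) (V w)) 0) *
    \1_(optimal_event (avoids b k) (fun M => ghost_count M == c)) (V w)).

(** The identity holds for each single [b]. It is summed because only the sum over [b] of the
    indicators of [(g, b) \in M] is a function of the number of ghost edges. *)
Lemma ghost_moment_exchange k c (psi : R -> R) : (k.+1 <= minn m n.+1)%N ->
  bounded_measurable (fun x : R => psi (Num.max x 0)) ->
  n.+1%:R * ghost_moment P V k.+1 c psi =
  (m - k + c)%:R / ((m - k + c)%:R + h) * avoids_moment_sum k c psi +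
  (if c is c'.+1 then h / ((m - k + c')%:R + h) * avoids_moment_sum k c' psi else 0).
Proof.
move=> kmn bpsi.
transitivity (\sum_(b < n.+1) ghost_moment P V k.+1 c psi).
  by rewrite sumr_const card_ord mulr_natl.
under eq_bigr => b _ do rewrite /ghost_moment (expectation_exchange PV b kmn bpsi c).
rewrite big_split/= -mulr_sumr; congr (_ + _).
case: c => [|c]; first by rewrite big1.
by rewrite -mulr_sumr.
Qed.

Lemma avoids_moment_by_parts k c (phi phi' : R -> R) : (k.+1 <= minn m n.+1)%N ->
  (forall x : R, is_derive x 1 phi (phi' x)) -> continuous phi' ->
  bounded_measurable (fun x : R => phi (Num.max x 0)) ->
  bounded_measurable (fun x : R => phi' (Num.max x 0)) ->
  avoids_moment_sum k c phi =
  n.+1%:R * ghost_moment P' V' k c phi +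
  h^-1 * (c.+1%:R * ghost_moment P V k.+1 c.+1 phi').
Proof.
move=> kmn dphi cphi' bphi bphi'.
rewrite /avoids_moment_sum.
under eq_bigr => b _ do rewrite (expectation_ghost_by_parts PV b kmn dphi cphi' bphi bphi' c)
  (avoids_moment b k c bphi).
rewrite big_split/= sumr_const card_ord mulr_natl; congr (_ + _).
rewrite -mulr_sumr; congr (_ * _).
have bw Q : bounded_measurable (fun w => phi' (Num.max (optimum (kmatching k.+1) (V w)) 0) *
    \1_(optimal_event (kmatching k.+1) Q) (V w)).
  exact: (bounded_measurable_weighted_event PV (kmatching k.+1) (kmatching k.+1) _ bphi').
rewrite -Rintegral_fsum//.
rewrite /ghost_moment -RintegralZl//; last exact/Rintegral_bounded_integrable/bw.
apply: ae_eq_Rintegral.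
- by apply: bounded_measurable_sum => b _; exact: bw.
- by apply: bounded_measurableM; [exact: bounded_measurable_cst|exact: bw].
apply: filterS (ae_cost_injective PV) => w inj.
have [M p1] := optimal_kmatching_exists ord0 kmn (V w).
under eq_bigr do rewrite (indic_optimal_event _ inj p1).
rewrite (indic_optimal_event _ inj p1) -mulr_sumr mulrCA; congr (_ * _).
case: eqP => gM; last first.
  by rewrite mulr0 big1// => b _; rewrite andbF.
under eq_bigr do rewrite andbT.
by rewrite mulr1 -gM ghost_count_sum natr_sum.
Qed.
End ghost_moment_recursion.

Local Open Scope complex_scope.

Section test_functions.
Context (R : realType) (t : R[i]).
Local Notation a := (complex.Re t).
Local Notation b := (complex.Im t).

Definition exp_re (x : R) : R := expR (a * x) * cos (b * x).
Definition exp_im (x : R) : R := expR (a * x) * sin (b * x).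

Let dscale (c x : R) : is_derive x 1 (fun x : R => c * x) c.
Proof.
have h1 := is_deriveZ c (is_derive_id x (1 : R)).
by apply: is_derive_eq h1 _; rewrite [LHS]mulr1.
Qed.

Let dexp (x : R) : is_derive x 1 (fun x : R => expR (a * x)) (expR (a * x) * a).
Proof. exact: (is_derive1_comp (is_derive_expR (a * x)) (dscale a x)). Qed.

Let dcos (x : R) : is_derive x 1 (fun x : R => cos (b * x)) (- sin (b * x) * b).
Proof. exact: (is_derive1_comp (is_derive_cos (b * x)) (dscale b x)). Qed.

Let dsin (x : R) : is_derive x 1 (fun x : R => sin (b * x)) (cos (b * x) * b).
Proof. exact: (is_derive1_comp (is_derive_sin (b * x)) (dscale b x)). Qed.

Lemma is_derive_exp_re (x : R) : is_derive x 1 exp_re (a * exp_re x + (- b) * exp_im x).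
Proof.
apply: is_derive_eq (is_deriveM (dexp x) (dcos x)) _.
by rewrite /exp_re /exp_im /GRing.scale /=; ring.
Qed.

Lemma is_derive_exp_im (x : R) : is_derive x 1 exp_im (a * exp_im x + b * exp_re x).
Proof.
apply: is_derive_eq (is_deriveM (dexp x) (dsin x)) _.
by rewrite /exp_re /exp_im /GRing.scale /=; ring.
Qed.

Lemma continuous_exp_re : continuous exp_re.
Proof.
by move=> x; apply/differentiable_continuous/derivable1_diffP; case: (is_derive_exp_re x).
Qed.

Lemma continuous_exp_im : continuous exp_im.
Proof.
by move=> x; apply/differentiable_continuous/derivable1_diffP; case: (is_derive_exp_im x).
Qed.

Hypothesis a0 : a <= 0.

Lemma bounded_measurable_max (f : R -> R) : continuous f ->
  (forall x, 0 <= x -> `|f x| <= 1) -> bounded_measurable (fun x : R => f (Num.max x 0)).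
Proof.
move=> cf f1; split; last by exists 1 => x; apply: f1; rewrite le_max lexx orbT.
apply: measurableT_comp; first exact: continuous_measurable_fun.
exact: measurable_maxr.
Qed.

Lemma bounded_measurable_exp_re : bounded_measurable (fun x : R => exp_re (Num.max x 0)).
Proof.
apply: bounded_measurable_max; first exact: continuous_exp_re.
move=> x x0; rewrite /exp_re normrM ger0_norm ?expR_ge0//.
rewrite mulr_ile1 ?expR_ge0//; last by rewrite ler_norml cos_geN1 cos_le1.
by rewrite -[leRHS]expR0 ler_expR mulr_le0_ge0.
Qed.

Lemma bounded_measurable_exp_im : bounded_measurable (fun x : R => exp_im (Num.max x 0)).
Proof.
apply: bounded_measurable_max; first exact: continuous_exp_im.
move=> x x0; rewrite /exp_im normrM ger0_norm ?expR_ge0//.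
rewrite mulr_ile1 ?expR_ge0//; last by rewrite ler_norml sin_geN1 sin_le1.
by rewrite -[leRHS]expR0 ler_expR mulr_le0_ge0.
Qed.

Lemma cexp_re_im (x : R) : cexp (t * x%:C) = exp_re x +i* exp_im x.
Proof.
rewrite /cexp /exp_re /exp_im; case: (t) => u v /=.
by apply/eqP; rewrite eq_complex /= !mulr0 !mul0r ?subr0 ?addr0 ?add0r !eqxx.
Qed.
End test_functions.

Section product_law_of_costs.
Context (R : realType) (h : R) (h0 : 0 < h) (m n : nat).
Context d (T : measurableType d) (P : probability T R) (X : edge m n -> {RV P >-> R}).

Definition costs (w : T) : vec R (edge m n) := fun e => X e w.

Lemma ghost_edge_costs_law : ghost_edge_costs h X -> has_product_law (@edge_law R h h0 m n) P costs.
Proof.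
move=> [indep expX]; split; first by apply: measurable_vec => e; exact: measurable_funPT.
move=> S mS.
have -> : costs @^-1` cylinder S = \bigcap_(i in [set` finset.setT]) (X i @^-1` S i).
  apply/seteqP; split=> w /= hw e; first by move=> _; exact: hw.
  by apply: hw => /=; rewrite inE.
apply: etrans (indep finset.setT S _) _; first by move=> e _; exact: mS.
apply: eq_big => [e|e _]; first by rewrite inE.
have := expX e (S e) (mS e); rewrite /distribution /pushforward => ->.
by rewrite /edge_law; case: ifP.
Qed.

Lemma min_cost_optimum k w : min_cost X k w = optimum (kmatching k) (costs w).
Proof. by []. Qed.

Lemma ghost_event_optimal k c : (k <= minn m n)%N ->
  ghost_event X k c = costs @^-1` (optimal_event (kmatching k) (fun M => ghost_count M == c)).
Proof.
move=> kmn; apply/seteqP; split=> w.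
  move=> [M [kM cM gM]]; exists M; rewrite gM eqxx andbT; apply/optimalP; split=> // N kN.
  have [M0 o0] := optimal_exists (costs w) kM.
  have -> : cost (costs w) M = cost (costs w) M0.
    by rewrite -(optimum_optimal o0) -min_cost_optimum -cM.
  by have /optimalP[_] := o0; exact.
move=> [M /andP[oM /eqP gM]]; exists M; split=> //; first by have /optimalP[] := oM.
by rewrite min_cost_optimum (optimum_optimal oM).
Qed.

Hypothesis HX : ghost_edge_costs h X.
Context (t : R[i]) (t0 : complex.Re t <= 0).

Definition ghost_mgf (k c : nat) : R[i] :=
  ghost_moment P costs k c (exp_re t) +i* ghost_moment P costs k c (exp_im t).

Lemma cexpectation_ghost_mgf k c : (k <= minn m n)%N ->
  cexpectation P (fun w => cexp (t * (min_cost X k w)%:C) * (\1_(ghost_event X k c) w)%:C) =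
  ghost_mgf k c.
Proof.
move=> kmn; have PV := ghost_edge_costs_law HX.
have key (f : R -> R) : continuous f -> bounded_measurable (fun x : R => f (Num.max x 0)) ->
    fine 'E_P[fun w => f (min_cost X k w) * \1_(ghost_event X k c) w] =
    ghost_moment P costs k c f.
  move=> cf bf; rewrite unlock; congr fine.
  have mev : measurable_fun setT (fun w => \1_(ghost_event X k c) w : R).
    apply: measurable_indic; rewrite ghost_event_optimal// -[X in measurable X]setTI.
    by case: PV => mV _; apply: mV => //; exact: measurable_optimal_event.
  have mopt : measurable_fun setT (fun w => optimum (kmatching k) (costs w)).
    by case: PV => mV _; exact: (measurableT_comp (measurable_optimum (kmatching k)) mV).
  apply: ae_eq_integral => //.
  - apply/measurable_EFinP; apply: measurable_funM => //.
    by apply: measurableT_comp => //; exact: continuous_measurable_fun.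
  - apply/measurable_EFinP.
    by have [] := bounded_measurable_weighted_event PV (kmatching k) (kmatching k)
      (fun M => ghost_count M == c) bf.
  apply: filterS (ae_cost_ge0 PV) => w w0 _; congr (_%:E).
  rewrite min_cost_optimum ghost_event_optimal//; congr (f _ * _).
  rewrite max_l//; have [M /andP[kM _]] := kmatching_exists kmn.
  have [M0 o0] := optimal_exists (costs w) kM.
  by rewrite (optimum_optimal o0); apply: sumr_ge0.
rewrite /cexpectation /ghost_mgf; congr (_ +i* _).
  rewrite -key; [|exact: continuous_exp_re|exact: bounded_measurable_exp_re].
  congr (fine 'E_P[_]); apply/funext => w; rewrite cexp_re_im /=.
  by rewrite mulr0 subr0.
rewrite -key; [|exact: continuous_exp_im|exact: bounded_measurable_exp_im].
congr (fine 'E_P[_]); apply/funext => w; rewrite cexp_re_im /=.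
by rewrite mulr0 add0r.
Qed.

End product_law_of_costs.

Lemma bounded_measurable_combination (R : realType) (f g : R -> R) (a b : R) :
  bounded_measurable (fun x : R => f (Num.max x 0)) ->
  bounded_measurable (fun x : R => g (Num.max x 0)) ->
  bounded_measurable (fun x : R => a * f (Num.max x 0) + b * g (Num.max x 0)).
Proof.
move=> bf bg; apply: bounded_measurableD.
  by apply: bounded_measurableM => //; exact: bounded_measurable_cst.
by apply: bounded_measurableM => //; exact: bounded_measurable_cst.
Qed.

Lemma continuous_combination (R : realType) (f g : R -> R) (a b : R) :
  continuous f -> continuous g -> continuous (fun x : R => a * f x + b * g x).
Proof.
move=> cf cg x; apply: cvgD.
  by apply: cvgM; [exact: cvg_cst|exact: cf].
by apply: cvgM; [exact: cvg_cst|exact: cg].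
Qed.

Lemma realC_mul (R : realType) (r u v : R) : r%:C * (u +i* v) = (r * u) +i* (r * v).
Proof. by apply/eqP; rewrite eq_complex /= !mul0r subr0 addr0 !eqxx. Qed.

(** * The recursion for a fixed h *)

Section finite_recursion.
Context (R : realType) (h : R) (h0 : 0 < h) (m n : nat).
Context d (T : measurableType d) (P : probability T R) (X : edge m n.+1 -> {RV P >-> R}).
Context d' (T' : measurableType d') (P' : probability T' R) (X' : edge m n -> {RV P' >-> R}).
Hypothesis HX : ghost_edge_costs h X.
Hypothesis HX' : ghost_edge_costs h X'.
Context (t : R[i]) (t0 : complex.Re t <= 0) (k : nat) (kmn : (k.+1 <= minn m n.+1)%N).
Local Notation PV := (ghost_edge_costs_law h0 HX).
Local Notation PV' := (ghost_edge_costs_law h0 HX').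

Definition avoids_mgf c : R[i] :=
  avoids_moment_sum P (costs X) k c (exp_re t) +i* avoids_moment_sum P (costs X) k c (exp_im t).

Lemma ghost_mgf_exchange c :
  n.+1%:R * ghost_mgf X t k.+1 c =
  ((m - k + c)%:R / ((m - k + c)%:R + h))%:C * avoids_mgf c +
  (if c is c'.+1 then (h / ((m - k + c')%:R + h))%:C * avoids_mgf c' else 0).
Proof.
have e1 := ghost_moment_exchange PV c kmn (bounded_measurable_exp_re t0).
have e2 := ghost_moment_exchange PV c kmn (bounded_measurable_exp_im t0).
have -> : n.+1%:R = (n.+1%:R : R)%:C by rewrite rmorph_nat.
rewrite /ghost_mgf /avoids_mgf !realC_mul e1 e2.
by case: c {e1 e2} => [|c]; rewrite ?realC_mul// !addr0.
Qed.

Lemma avoids_mgf_by_parts c :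
  avoids_mgf c = n.+1%:R * ghost_mgf X' t k c +
    (h^-1)%:C * (c.+1%:R * (t * ghost_mgf X t k.+1 c.+1)).
Proof.
have bre := bounded_measurable_exp_re t0; have bim := bounded_measurable_exp_im t0.
have cre := @continuous_exp_re _ t; have cim := @continuous_exp_im _ t.
have e1 := avoids_moment_by_parts PV PV' c kmn (is_derive_exp_re t)
  (@continuous_combination _ _ _ (complex.Re t) (- complex.Im t) cre cim) bre (@bounded_measurable_combination _ _ _ (complex.Re t) (- complex.Im t) bre bim).
have e2 := avoids_moment_by_parts PV PV' c kmn (is_derive_exp_im t)
  (@continuous_combination _ _ _ (complex.Re t) (complex.Im t) cim cre) bim (@bounded_measurable_combination _ _ _ (complex.Re t) (complex.Im t) bim bre).
rewrite (ghost_moment_linear PV bre bim k.+1 c.+1 (fun x => erefl)) in e1.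
rewrite (ghost_moment_linear PV bim bre k.+1 c.+1 (fun x => erefl)) in e2.
have nC p : p%:R = (p%:R : R)%:C by rewrite rmorph_nat.
rewrite /avoids_mgf e1 e2 /ghost_mgf !nC.
case: (t) => u v; apply/eqP; rewrite eq_complex /=.
by apply/andP; split; apply/eqP; ring.
Qed.

(** Division by h^c absorbs the factor h of the exchange and the h^-1 of the integration by parts.
    The left-hand quantity reappears in the last term, because the integration by parts applied to
    [M'] with [c'] ghost edges yields [M] with [c'.+1 = c] of them. *)
Lemma scaled_ghost_mgf_recursion c :
  scaled_ghost_mgf X k.+1 c h t =
  ((m - k + c)%:R / ((m - k + c)%:R + h))%:C *
    (scaled_ghost_mgf X' k c h t + c.+1%:R / n.+1%:R * t * scaled_ghost_mgf X k.+1 c.+1 h t) +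
  (if c is c'.+1 then (((m - k + c')%:R + h)^-1)%:C *
    (scaled_ghost_mgf X' k c' h t + c%:R / n.+1%:R * t * scaled_ghost_mgf X k.+1 c h t) else 0) :> R[i].
Proof.
have kmn' : (k <= minn m n)%N by move: kmn; rewrite !leq_min => /andP[/ltnW-> /=]; rewrite ltnS.
rewrite /scaled_ghost_mgf !(cexpectation_ghost_mgf h0 HX t0 _ kmn).
rewrite !(cexpectation_ghost_mgf h0 HX' t0 _ kmn').
have n0 : (n.+1%:R : R[i]) != 0 by rewrite pnatr_eq0.
have hC0 : h%:C != 0 by rewrite (inj_eq (@complexI R)) gt_eqF.
have hX j : (h ^+ j)%:C = h%:C ^+ j by rewrite rmorphXn.
have hX0 j : h%:C ^+ j != 0 by exact: expf_neq0.
have hV : (h^-1)%:C = (h%:C)^-1 by rewrite fmorphV.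
have uE j : ghost_mgf X t k.+1 j = n.+1%:R^-1 * (n.+1%:R * ghost_mgf X t k.+1 j).
  by rewrite mulKf.
have e1 := ghost_mgf_exchange c.
rewrite !hX [in LHS]uE e1 !avoids_mgf_by_parts hV.
set alpha := (_ / _)%:C; clearbody alpha.
case: c {e1} => [|c].
  rewrite !addr0 expr0 expr1 invr1 !mul1r.
  set u := ghost_mgf _ _ _ _; set v := ghost_mgf _ _ _ _; clearbody u v.
  by field; rewrite hC0 nat1r.
rewrite !(cexpectation_ghost_mgf h0 HX' t0 _ kmn') !hX avoids_mgf_by_parts hV.
have -> : (h / ((m - k + c)%:R + h))%:C = h%:C * (((m - k + c)%:R + h)^-1)%:C.
  by rewrite rmorphM.
set beta := (_^-1)%:C; clearbody beta.
rewrite !exprS; have := hX0 c; move: (h%:C ^+ c) => y y0.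
move: (ghost_mgf X' t k c.+1) (ghost_mgf X' t k c) (ghost_mgf X t k.+1 c.+2) (ghost_mgf X t k.+1 c.+1).
move: (h%:C) hC0 (c.+1%:R : R[i]) (c.+2%:R : R[i]) (n.+1%:R : R[i]) n0 => z z0 c1 c2 N N0 p q r s.
by field; rewrite y0 N0 z0.
Qed.
End finite_recursion.

(** * Rational functions and limits *)

Section recursive_solution.
Context (K : fieldType) (t : K).

(** Covers both equations of the recursion: for [d = 0] the first factor is 1, also when [m = k],
    and the first summand is absent. *)
Definition gf_step (m n k d : nat) (prev : nat -> K) (next : K) : K :=
  (1 - (d%:R * t) / ((m - k + d)%N%:R * n%:R))^-1 *
  ((if d is d'.+1 then (m - k + d)%N%:R^-1 * prev d' else 0)
   + d.+1%:R / n%:R * t * next + prev d).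

(* The value at [d = k - i]. *)
Fixpoint gf_descent (m n k : nat) (prev : nat -> K) (i : nat) : K :=
  gf_step m n k (k - i) prev (if i is i'.+1 then gf_descent m n k prev i' else 0).

(** The field is arbitrary so that one definition yields both the rational function, at the
    indeterminate, and its values at complex [t]. *)
Fixpoint gf_solution (k m n d : nat) : K :=
  if k is k'.+1 then
    if (d <= k)%N then gf_descent m n k (gf_solution k' m n.-1) (k - d) else 0
  else (d == 0%N)%:R.

Lemma gf_solution_gt k m n d : (k < d)%N -> gf_solution k m n d = 0.
Proof. by case: k => [|k] kd /=; [case: d kd|rewrite leqNgt kd]. Qed.

Lemma gf_solutionS k m n d : (d <= k.+1)%N ->
  gf_solution k.+1 m n d =
  gf_step m n k.+1 d (gf_solution k m n.-1) (gf_solution k.+1 m n d.+1).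
Proof.
move=> dk; rewrite [LHS]/= dk.
have [dlt|] := ltnP d k.+1; last first.
  move=> kd; have -> : d = k.+1 by apply/eqP; rewrite eqn_leq dk.
  by rewrite subnn /= subn0 leqNgt ltnSn.
have di : (k.+1 - d = (k.+1 - d.+1).+1)%N by rewrite subnSK.
have dE : (k.+1 - (k.+1 - d.+1).+1 = d)%N by rewrite -di subKn.
rewrite di; move: dE; set i := (k.+1 - d.+1)%N => dE.
rewrite -[LHS]/(gf_step m n k.+1 (k.+1 - i.+1) _ (gf_descent m n k.+1 _ i)) dE.
by congr gf_step; rewrite /= dlt.
Qed.
End recursive_solution.

Lemma gf_solution_ind (Q : nat -> nat -> nat -> nat -> Prop) :
  (forall m n d, Q 0%N m n d) ->
  (forall k m n d, (k.+1 < d)%N -> Q k.+1 m n d) ->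
  (forall k m n d, (d <= k.+1)%N -> (forall c, Q k m n.-1 c) -> Q k.+1 m n d.+1 -> Q k.+1 m n d) ->
  forall k m n d, Q k m n d.
Proof.
move=> Q0 Qgt Qstep; elim=> [|k IH] m n d; first exact: Q0.
have [/Qgt//|dk] := ltnP k.+1 d.
rewrite -(subKn dk); elim: (k.+1 - d)%N => [|i IHi].
  by rewrite subn0; apply: Qstep => //; exact: Qgt.
(* Once [i] exceeds [k], the truncated differences are 0 and nothing remains to prove. *)
have [ik|ki] := ltnP i k.+1; last first.
  have zi : (k.+1 - i = 0)%N by apply/eqP; rewrite subn_eq0.
  have zi1 : (k.+1 - i.+1 = 0)%N by apply/eqP; rewrite subn_eq0 ltnW.
  by move: IHi; rewrite zi zi1.
apply: Qstep => //; first exact: leq_subr.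
by rewrite subnSK.
Qed.

(** * Rational functions without poles in a given set *)

Section representation.
Context (R : realType) (D : set R[i]) (D0 : D 0).
Implicit Types (F G : {fraction {poly R[i]}}) (f g : R[i] -> R[i]).
Local Notation toF := (@FracField.tofrac {poly R[i]}).

Let den_neq0 (den : {poly R[i]}) : (forall t, D t -> den.[t] != 0) -> toF den != 0.
Proof.
move=> h; rewrite tofrac_eq0; apply: contraNneq (h 0 D0) => ->.
by rewrite horner0.
Qed.

Lemma represents_const (c : R[i]) : represents D (toF c%:P) (fun=> c).
Proof.
exists c%:P, 1; split; first by rewrite tofrac1 divr1.
by move=> t _; rewrite !hornerE oner_eq0 divr1.
Qed.

Lemma represents_X : represents D (ratX R) id.
Proof.
exists 'X, 1; split; first by rewrite tofrac1 divr1.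
by move=> t _; rewrite !hornerE oner_eq0 divr1.
Qed.

Lemma represents_add F G f g : represents D F f -> represents D G g ->
  represents D (F + G) (fun t => f t + g t).
Proof.
move=> [n1 [d1 [-> h1]]] [n2 [d2 [-> h2]]].
have z1 : toF d1 != 0 by apply: den_neq0 => t /h1[].
have z2 : toF d2 != 0 by apply: den_neq0 => t /h2[].
exists (n1 * d2 + n2 * d1), (d1 * d2); split.
  rewrite (tofracD (n1 * d2)) (tofracM n1 d2) (tofracM n2 d1) (tofracM d1 d2).
  exact: (addf_div _ _ z1 z2).
move=> t Dt; have [dt1 ->] := h1 t Dt; have [dt2 ->] := h2 t Dt.
by rewrite !hornerE mulf_neq0// addf_div.
Qed.

Lemma represents_mul F G f g : represents D F f -> represents D G g ->
  represents D (F * G) (fun t => f t * g t).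
Proof.
move=> [n1 [d1 [-> h1]]] [n2 [d2 [-> h2]]].
exists (n1 * n2), (d1 * d2); split; first by rewrite (tofracM n1 n2) (tofracM d1 d2); exact: mulf_div.
move=> t Dt; have [dt1 ->] := h1 t Dt; have [dt2 ->] := h2 t Dt.
by rewrite !hornerM mulf_neq0//; split=> //; exact: mulf_div.
Qed.

Lemma represents_inv F f : represents D F f -> (forall t, D t -> f t != 0) ->
  represents D F^-1 (fun t => (f t)^-1).
Proof.
move=> [n1 [d1 [-> h1]]] f0; exists d1, n1; split; first by rewrite invf_div.
move=> t Dt; have [dt1 fE] := h1 t Dt; rewrite fE invf_div; split=> //.
by apply: contraNneq (f0 t Dt) => nt; rewrite fE nt mul0r.
Qed.

Lemma represents_ext F f g : represents D F f -> (forall t, D t -> f t = g t) ->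
  represents D F g.
Proof.
move=> [n1 [d1 [-> h1]]] fg; exists n1, d1; split=> // t Dt.
by rewrite -fg//; exact: h1.
Qed.

Lemma represents0 : represents D 0 (fun=> 0).
Proof.
exists 0, 1; split; first by rewrite tofrac0 mul0r.
by move=> t _; rewrite horner0 mul0r hornerC oner_eq0.
Qed.

Lemma represents1 : represents D 1 (fun=> 1).
Proof.
exists 1, 1; split; first by rewrite tofrac1 divr1.
by move=> t _; rewrite hornerC oner_eq0 divr1.
Qed.

Lemma represents_nat p : represents D p%:R (fun=> p%:R).
Proof.
have -> : p%:R = toF (p%:R)%:P by rewrite polyCMn tofracMn tofrac1.
exact: represents_const.
Qed.

Lemma represents_natV p : represents D p%:R^-1 (fun=> p%:R^-1).
Proof.
have [->|p0] := eqVneq p 0%N; first by rewrite !invr0; exact: represents0.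
by apply: represents_inv; [exact: represents_nat|move=> t _; rewrite pnatr_eq0].
Qed.

Lemma represents_opp F f : represents D F f -> represents D (- F) (fun t => - f t).
Proof.
move=> [n1 [d1 [-> h1]]]; exists (- n1), d1; split; first by rewrite tofracN mulNr.
by move=> t Dt; have [dt1 ->] := h1 t Dt; rewrite hornerN mulNr.
Qed.
End representation.

(** The real part is at least 1. *)
Lemma one_sub_realC_neq0 (R : realType) (c : R) (t : R[i]) : 0 <= c -> complex.Re t <= 0 ->
  1 - c%:C * t != 0.
Proof.
move=> c0 t0; apply/eqP => /(congr1 (@complex.Re R)).
case: t t0 => u v /= u0; rewrite mul0r subr0 => h.
have : c * u <= 0 by rewrite mulr_ge0_le0.
by move: h; lra.
Qed.

Lemma gf_factor_neq0 (R : realType) (t : R[i]) (p q : nat) : complex.Re t <= 0 ->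
  1 - (p%:R * t) / (q%:R : R[i]) != 0.
Proof.
have -> : p%:R * t / q%:R = (p%:R / q%:R : R)%:C * t.
  by rewrite rmorphM fmorphV !rmorph_nat mulrAC.
by apply: one_sub_realC_neq0; rewrite divr_ge0.
Qed.

(** Apart from constants, the recursion inverts only the first factor of [gf_step], which has no
    zero in the half-plane. *)
Lemma represents_gf_solution (R : realType) k m n d :
  represents (@closed_left_halfplane R) (gf_solution (ratX R) k m n d)
    (fun t => gf_solution t k m n d).
Proof.
have D0 : @closed_left_halfplane R 0 by rewrite /closed_left_halfplane /=.
move: k m n d; apply: gf_solution_ind.
- by move=> m n d /=; exact: represents_nat.
- move=> k m n d kd; rewrite gf_solution_gt//.
  have h0 : represents (@closed_left_halfplane R) 0 (fun=> 0) by exact: represents0.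
  by apply: (represents_ext h0) => t _; rewrite gf_solution_gt.
move=> k m n d dk IHk IHd; rewrite gf_solutionS//.
apply: represents_ext (fun t => gf_step t m n k.+1 d (gf_solution t k m n.-1) (gf_solution t k.+1 m n d.+1)) _ _ _; last first.
  by move=> t _; rewrite [RHS]gf_solutionS.
rewrite /gf_step; apply: represents_mul => //.
  apply: represents_inv => //.
    apply: represents_add => //; first exact: represents1.
    apply: represents_opp => //; apply: represents_mul => //.
      by apply: represents_mul => //; [exact: represents_nat|exact: represents_X].
    by rewrite -natrM; apply: (represents_ext (represents_natV (@closed_left_halfplane R) ((m - k.+1 + d) * n)%N)) => t _; rewrite natrM.
  by move=> t t0; rewrite -natrM; exact: gf_factor_neq0.
apply: represents_add => //; apply: represents_add => //.
  case: d {dk IHd} => [|d]; first exact: represents0.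
  by apply: represents_mul => //; exact: represents_natV.
apply: represents_mul => //; apply: represents_mul => //; last exact: represents_X.
by apply: represents_mul => //; [exact: represents_nat|exact: represents_natV].
Qed.

Lemma cvg_realC (R : realType) (I : Type) (F : set_system I) (FF : Filter F)
    (f : I -> R) (a : R) :
  f x @[x --> F] --> a -> ((f x)%:C : R[i]^o) @[x --> F] --> (a%:C : R[i]^o).
Proof.
move=> /cvgrPdist_lt fa; apply/cvgrPdist_lt => e e0.
have e1 : e = (complex.Re e)%:C.
  by apply/eqP; rewrite eq_complex /= eqxx /=; move: e0; rewrite ltcE /= => /andP[/eqP->].
have re0 : 0 < complex.Re e by move: e0; rewrite ltcE /= => /andP[].
apply: filterS (fa _ re0) => x; rewrite e1 -rmorphB /= normc_def /= expr0n addr0 sqrtr_sqr.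
by rewrite ltcR.
Qed.

(** For fixed [h] the recursion is a linear equation for the unknown with an invertible coefficient.
    Solving it before passing to the limit leaves only terms whose convergence is known by
    induction. *)
Lemma cvg_scaled_ghost_mgf (R : realType) (disp : nat -> nat -> measure_display)
    (T : forall m n : nat, R -> measurableType (disp m n))
    (P : forall (m n : nat) (h : R), probability (T m n h) R)
    (X : forall (m n : nat) (h : R), edge m n -> {RV (P m n h) >-> R})
    (HX : forall (m n : nat) (h : R), 0 < h -> ghost_edge_costs h (X m n h))
    (t : R[i]) (t0 : complex.Re t <= 0) (k m n d : nat) : (k <= minn m n)%N ->
  scaled_ghost_mgf (X m n h) k d h t @[h --> 0^'+] --> (gf_solution t k m n d : R[i]^o).
Proof.
move: k m n d; apply: gf_solution_ind.
- move=> m n d _.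
  apply: (@cvg_trans _ ((fun _ : R => (d == 0%N)%:R : R[i]^o) @ 0^'+)); last exact: cvg_cst.
  apply: near_eq_cvg; near=> h.
  have h0 : 0 < h by near: h; exact: nbhs_right_gt.
  rewrite /scaled_ghost_mgf (cexpectation_ghost_mgf h0 (HX m n h h0) t0)// /ghost_mgf.
  rewrite !ghost_moment0 /exp_re /exp_im !mulr0 expR0 cos0 sin0 mulr1 mulr0 mul1r mul0r.
  case: d => [|d] /=; first by rewrite invr1 mul1r.
  by rewrite -[0 +i* 0]/(0 : R[i]) mulr0.
- move=> k m n d kd kmn; rewrite gf_solution_gt//.
  apply: (@cvg_trans _ ((fun _ : R => 0 : R[i]^o) @ 0^'+)); last exact: cvg_cst.
  apply: near_eq_cvg; near=> h.
  have h0 : 0 < h by near: h; exact: nbhs_right_gt.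
  rewrite /scaled_ghost_mgf (cexpectation_ghost_mgf h0 (HX m n h h0) t0)// /ghost_mgf.
  by rewrite !ghost_moment_gt// -[0 +i* 0]/(0 : R[i]) mulr0.
move=> k m [|n] d dk IHk IHd kmn; first by exfalso; move: kmn; rewrite minn0.
rewrite (gf_solutionS _ _ _ dk).
have kmn' : (k <= minn m n)%N by move: kmn; rewrite !leq_min => /andP[/ltnW-> /=]; rewrite ltnS.
pose alpha (h : R) := ((m - k + d)%:R / ((m - k + d)%:R + h))%:C.
pose beta (h : R) := (((m - k.+1 + d)%:R + h)^-1)%:C.
pose L c (h : R) : R[i]^o := scaled_ghost_mgf (X m n h) k c h t.
pose L1 (h : R) : R[i]^o := scaled_ghost_mgf (X m n.+1 h) k.+1 d.+1 h t.
have km : (k.+1 <= m)%N by move: kmn; rewrite leq_min => /andP[].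
(* The recursion solved for the unknown: [alpha] tends to 1 and, for positive [d], [beta] to the
   reciprocal of [m - k.+1 + d]. *)
pose G (h : R) : R[i]^o := (1 - beta h * (d%:R * t / n.+1%:R))^-1 *
  (alpha h * (L d h + d.+1%:R / n.+1%:R * t * L1 h) + (if d is d'.+1 then beta h * L d' h else 0)).
have cL c : L c h @[h --> 0^'+] --> (gf_solution t k m n c : R[i]^o) by exact: IHk.
have cL1 : L1 h @[h --> 0^'+] --> (gf_solution t k.+1 m n.+1 d.+1 : R[i]^o) by exact: IHd.
have ch : (h : R) @[h --> 0^'+] --> (0 : R) by exact: cvg_at_right_filter.
have cadd (p : R) : (p + h) @[h --> 0^'+] --> p.
  by rewrite -[X in _ --> X]addr0; apply: cvgD => //; exact: cvg_cst.
have calpha : (alpha h : R[i]^o) @[h --> 0^'+] --> (1 : R[i]^o).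
  apply: (@cvg_realC _ _ _ _ _ 1).
  have r0 : (m - k + d)%:R != 0 :> R by rewrite pnatr_eq0 -lt0n addn_gt0 subn_gt0 km.
  rewrite -[X in _ --> X](divff r0); apply: cvgM; first exact: cvg_cst.
  by apply: cvgV => //; exact: cadd.
(* For [d = 0] and [m = k.+1] the function [beta] is 1/h and diverges; but for [d = 0] it occurs in
   [G] only with the factor [d%:R], which is 0. *)
have cbeta : (0 < d)%N -> (beta h : R[i]^o) @[h --> 0^'+] --> ((m - k.+1 + d)%:R^-1 : R[i]^o).
  move=> d0.
  have r0 : (m - k.+1 + d)%:R != 0 :> R by rewrite pnatr_eq0 -lt0n addn_gt0 d0 orbT.
  have -> : ((m - k.+1 + d)%:R^-1 : R[i]) = ((m - k.+1 + d)%:R^-1 : R)%:C.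
    by rewrite fmorphV rmorph_nat.
  by apply: cvg_realC; apply: cvgV => //; exact: cadd.
have factor0 (h : R) : 0 <= h -> 1 - beta h * (d%:R * t / n.+1%:R) != 0.
  move=> h0; have -> : beta h * (d%:R * t / n.+1%:R) =
      (((m - k.+1 + d)%:R + h)^-1 * (d%:R / n.+1%:R))%:C * t.
    rewrite [in RHS]rmorphM -[RHS]mulrA; congr (_ * _).
    by rewrite rmorphM fmorphV !rmorph_nat mulrAC.
  by apply: one_sub_realC_neq0 => //; rewrite mulr_ge0 ?divr_ge0 ?invr_ge0 ?addr_ge0.
apply: (@cvg_trans _ (G @ 0^'+)).
  apply: near_eq_cvg; near=> h.
  have h0 : 0 < h by near: h; exact: nbhs_right_gt.
  have rec := scaled_ghost_mgf_recursion h0 (HX m n.+1 h h0) (HX m n h h0) t0 kmn d.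
  apply: (mulfI (factor0 h (ltW h0))); rewrite /G mulVKf; last exact: factor0 (ltW h0).
  move: rec; set s := scaled_ghost_mgf (X m n.+1 h) k.+1 d h t => rec.
  (* Isolates the term in the unknown [s]; for [e = 0] the added term has coefficient 0. *)
  have split_rec e (s' : R[i]) : (if e is c.+1 then (((m - k + c)%:R + h)^-1)%:C *
        (scaled_ghost_mgf (X m n h) k c h t + e%:R / n.+1%:R * t * s') else 0) =
      (if e is c.+1 then (((m - k.+1 + e)%:R + h)^-1)%:C * L c h else 0) +
      (((m - k.+1 + e)%:R + h)^-1)%:C * (e%:R * t / n.+1%:R) * s' :> R[i].
    case: e => [|e]; first by rewrite mul0r mul0r mulr0 mul0r addr0.
    have -> : (m - k + e = m - k.+1 + e.+1)%N by move: km; lia.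
    by rewrite mulrDr /L; congr (_ + _); rewrite !mulrA; congr (_ * _); rewrite mulrAC.
  apply/esym; rewrite [in LHS]mulrBl mul1r [in X in X - _]rec split_rec -[_ * _ * s]/(beta h * (d%:R * t / n.+1%:R) * s).
  by rewrite addrA addrK.
have cbranch : ((if d is d'.+1 then beta h * L d' h else 0) : R[i]^o) @[h --> 0^'+] -->
    ((if d is d'.+1 then (m - k.+1 + d)%:R^-1 * gf_solution t k m n d' else 0) : R[i]^o).
  case: d @alpha @beta {G L1 dk IHd cL1 calpha factor0} cbeta => [|c] alpha beta cbeta; first exact: cvg_cst.
  by apply: cvgM; [exact: cbeta|exact: cL].
have cfactor : (beta h * (d%:R * t / n.+1%:R) : R[i]^o) @[h --> 0^'+] -->
    ((d%:R * t) / ((m - k.+1 + d)%:R * n.+1%:R) : R[i]^o).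
  have [d0|d0] := posnP d.
    rewrite d0 !mul0r; under eq_fun do rewrite mulr0; exact: cvg_cst.
  have -> : (d%:R * t) / ((m - k.+1 + d)%:R * n.+1%:R) =
      (m - k.+1 + d)%:R^-1 * (d%:R * t / n.+1%:R) :> R[i].
    by rewrite invfM mulrCA.
  by apply: cvgM; [exact: cbeta|exact: cvg_cst].
have -> : gf_step t m n.+1 k.+1 d (gf_solution t k m n.+1.-1) (gf_solution t k.+1 m n.+1 d.+1) =
    (1 - (d%:R * t) / ((m - k.+1 + d)%:R * n.+1%:R))^-1 *
    (1 * (gf_solution t k m n d + d.+1%:R / n.+1%:R * t * gf_solution t k.+1 m n.+1 d.+1) +
     (if d is d'.+1 then (m - k.+1 + d)%:R^-1 * gf_solution t k m n d' else 0)).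
  by rewrite /gf_step; congr (_ * _); rewrite mul1r [RHS]addrC [in RHS](addrC (gf_solution _ _ _ _ _)) addrA.
apply: cvgM.
  apply: cvgV; first by rewrite -natrM; exact: gf_factor_neq0.
  by apply: cvgB; [exact: cvg_cst|exact: cfactor].
apply: cvgD; last exact: cbranch.
apply: cvgM; first exact: calpha.
apply: cvgD; first exact: cL.
by apply: cvgM; [exact: cvg_cst|exact: cL1].
Unshelve. all: by end_near.
Qed.

Theorem theorem8 (R : realType) (disp : nat -> nat -> measure_display)
    (T : forall m n : nat, R -> measurableType (disp m n))
    (P : forall (m n : nat) (h : R), probability (T m n h) R)
    (X : forall (m n : nat) (h : R), edge m n -> {RV (P m n h) >-> R})
    (HX : forall (m n : nat) (h : R), 0 < h -> ghost_edge_costs h (X m n h)) :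
  exists F : nat -> nat -> nat -> nat -> {fraction {poly R[i]}},
    [/\ forall k m n d : nat, (k <= minn m n)%N ->
          (forall t : R[i], complex.Re t <= 0 ->
             cvg (scaled_ghost_mgf (X m n h) k d h t @[h --> 0^'+])) /\
          represents (@closed_left_halfplane R) (F k m n d)
                     (ghost_gf (X m n) k d),
        forall m n' : nat, F 0%N m n' 0%N = 1
      & forall k m n : nat, (1 <= k <= minn m n)%N ->
        [/\ F k m n k.+1 = 0,
            F k.-1 m n.-1 k = 0,
            F k m n 0%N =
              ratX R / n%:R * F k m n 1%N + F k.-1 m n.-1 0%N
          & forall d : nat, (1 <= d <= k)%N ->
            F k m n d =
              (1 - (d%:R * ratX R) / ((m - k + d)%N%:R * n%:R))^-1 *
              ((m - k + d)%N%:R^-1 * F k.-1 m n.-1 d.-1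
               + d.+1%:R / n%:R * ratX R * F k m n d.+1
               + F k.-1 m n.-1 d)]].
Proof.
(* With the solution of the recursion as witness, the equations hold by construction; the content is
   that it represents the limits. *)
exists (gf_solution (ratX R)); split => [k m n d kmn|//|[//|k] m n kmn].
  split=> [t t0|]; first by apply/cvg_ex; exists (gf_solution t k m n d); exact: cvg_scaled_ghost_mgf.
  apply: represents_ext (represents_gf_solution R k m n d) _ => t t0.
  have hausd : hausdorff_space (R[i]^o) by exact: norm_hausdorff.
  exact/esym/(cvg_lim hausd)/(cvg_scaled_ghost_mgf HX).
split.
- by rewrite gf_solution_gt.
- by rewrite gf_solution_gt.
- rewrite gf_solutionS// /gf_step mul0r mul0r subr0 invr1 mul1r add0r.
  by congr (_ * _ + _); rewrite mulr1n mul1r mulrC.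
- by case=> [//|d] /andP[_ dk]; rewrite gf_solutionS.
Qed.
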